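(* Let $G$ be an additive abelian group. 1. If $G$ is finite, then there is a bound $M(G)\in\mathbb N_0$ such that, for every plus-minus weighted zero-sum sequence $S\in\mathcal B_{\pm}(G)$, its set of lengths $\mathsf L_{\mathcal B_{\pm}(G)}(S)$ is an almost arithmetic multiprogression (AAMP) with difference $d\in\Delta^*\big(\mathcal B_{\pm}(G)\big)$ and bound $M(G)$. 2. If $G$ is infinite, then, for every finite, nonempty subset $L\subset\mathbb N_{\ge 2}$ and every map $f\colon L\to\mathbb N$, there is an $S\in\mathcal B(G)$ with the following properties. (a) $S$ is squarefree in $\mathcal F(G)$. (b) $\mathsf L_{\mathcal B_{\pm}(G)}(S)=\mathsf L_{\mathcal B(G)}(S)=L$. (c) $|\mathsf Z_{\mathcal B_{\pm}(G),k}(S)|\ge|\mathsf Z_{\mathcal B(G),k}(S)|\ge f(k)$ for all $k\in L$. Moreover, both inequalities are equalities for every $k\in L$ with $k>\min L$.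
   Context: $\mathbb N$ is the set of positive integers, $\mathbb N_0=\mathbb N\cup\{0\}$, $\mathbb N_{\ge 2}=\{n\in\mathbb N: n\ge 2\}$, and $[a,b]=\{x\in\mathbb Z: a\le x\le b\}$. Sequences. For an additive abelian group $G$, $\mathcal F(G)$ is the (multiplicatively written) free abelian monoid with basis $G$; its elements, called sequences over $G$, are finite unordered sequences (multisets) $S=g_1\cdot\ldots\cdot g_\ell$. $S$ is squarefree if no $g\in G$ occurs more than once in $S$. $S$ is a zero-sum sequence if $g_1+\ldots+g_\ell=0$, and a plus-minus weighted zero-sum sequence if $\varepsilon_1g_1+\ldots+\varepsilon_\ell g_\ell=0$ for some $\varepsilon_1,\ldots,\varepsilon_\ell\in\{-1,1\}$. $\mathcal B(G)$ and $\mathcal B_{\pm}(G)$ are the submonoids of $\mathcal F(G)$ of all zero-sum, respectively plus-minus weighted zero-sum, sequences over $G$ (both contain the empty sequence $1$). Factorizations. Let $H$ be a commutative cancellative monoid whose only unit is $1$ (as holds for $\mathcal B(G)$ and $\mathcal B_\pm(G)$). An atom of $H$ is an element $a\ne 1$ such that $a=bc$ with $b,c\in H$ implies $b=1$ or $c=1$. A factorization of $a\in H$ is an element $z$ of the free abelian monoid on the set of atoms of $H$ (a finite multiset of atoms) whose product in $H$ is $a$; its length $|z|$ is the number of atoms in $z$ counted with multiplicity. $\mathsf Z_H(a)$ is the set of factorizations of $a$, $\mathsf Z_{H,k}(a)=\{z\in\mathsf Z_H(a):|z|=k\}$, and $\mathsf L_H(a)=\{|z|: z\in\mathsf Z_H(a)\}\subset\mathbb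 N_0$ is the set of lengths of $a$ (so $\mathsf L_H(1)=\{0\}$). Minimal distances. For a finite nonempty set $L=\{m_0<\ldots<m_k\}\subset\mathbb Z$, $\Delta(L)=\{m_i-m_{i-1}: i\in[1,k]\}$. A submonoid $S\subset H$ is divisor-closed if $b\in S$, $a\in H$ and $a\mid b$ in $H$ imply $a\in S$. If all sets of lengths in $H$ are finite and nonempty (true for $\mathcal B_\pm(G)$), then for a divisor-closed submonoid $S$ put $\Delta(S)=\bigcup_{a\in S}\Delta(\mathsf L_S(a))$, and $\Delta^*(H)=\{\min\Delta(S): S\subset H \text{ a divisor-closed submonoid with }\Delta(S)\ne\emptyset\}$ is the set of minimal distances of $H$. AAMPs. Let $d\in\mathbb N$, $M\in\mathbb N_0$ and $\{0,d\}\subset\mathcal D\subset[0,d]$. A set $L\subset \mathbb Z$ is an AAMP with difference $d$, period $\mathcal D$ and bound $M$ if $L=y+(L'\cup L^*\cup L'')\subset y+\mathcal D+d\mathbb Z$, where $y\in\mathbb Z$, $L^*$ is finite and nonempty with $\min L^*=0$ and $L^*=(\mathcal D+d\mathbb Z)\cap[0,\max L^*]$, $L'\subset[-M,-1]$, and $L''\subset\max L^*+[1,M]$. ''AAMP with difference $d$ and bound $M$'' means that this holds for some period $\mathcal D$.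
   Formalization: In part 1, if G has at most two elements, Δ*(B_±(G)) is empty and no difference d exists; for such G the formal statement asserts instead that each set of lengths is a singleton. *)

(* Defs.v *)
From mathcomp Require Import all_boot all_order all_algebra.
From mathcomp Require Import finmap multiset.
From mathcomp Require Import boolp classical_sets functions cardinality.

Set Implicit Arguments.
Unset Strict Implicit.
Unset Printing Implicit Defensive.

Import Order.TTheory GRing.Theory Num.Theory.

Local Open Scope mset_scope.
Local Open Scope classical_set_scope.
Local Open Scope ring_scope.

Definition least {d} {T : porderType d} (A : set T) : set T :=
  A `&` lbound A.

Definition greatest {d} {T : porderType d} (A : set T) : set T :=
  A `&` ubound A.

(* The free abelian monoid F(K) with basis K is {mset K}, with product `+`,
   unit mset0 and multiplicities given by application.  The monoids H below
   are submonoids of F(K); atoms, divisibility and factorizations are always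
   taken inside H, not inside F(K). *)
Section Factorizations.
Variable K : choiceType.
Implicit Types (H S : set {mset K}) (a b c : {mset K}).

Definition submonoid S : Prop :=
  S mset0 /\ forall a b, S a -> S b -> S (a `+` b)%mset.

Definition divides_in H a b : Prop := exists2 c, H c & b = (a `+` c)%mset.

Definition divisor_closed H S : Prop :=
  [/\ submonoid S, S `<=` H &
      forall a b, S b -> H a -> divides_in H a b -> S a].

Definition atom H a : Prop :=
  [/\ H a, a <> mset0 &
      forall b c, H b -> H c -> a = (b `+` c)%mset -> b = mset0 \/ c = mset0].

Definition factorizations H a : set {mset {mset K}} :=
  [set z : {mset {mset K}} | (forall u, u \in z -> atom H u) /\
     \big[msetD/mset0]_(u <- z) u = a].

Definition factorizations_of_length H (k : nat) a : set {mset {mset K}} :=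
  [set z : {mset {mset K}} | factorizations H a z /\ size z = k].

Definition lengths H a : set nat := [set size (z : {mset {mset K}}) | z in factorizations H a].

End Factorizations.

(* Sets of lengths are sets of natural numbers; distances and AAMPs are defined
   for sets of integers. *)
Definition int_set (L : set nat) : set int := [set n%:Z | n in L].

Definition distances (L : set int) : set nat :=
  [set d | exists m n : int, [/\ L m, L n, m < n,
     (forall k, L k -> ~~ (m < k < n)) & n = m + d%:Z]].

Definition monoid_distances (K : choiceType) (S : set {mset K}) : set nat :=
  [set d | exists2 a, S a & distances (int_set (lengths S a)) d].

Definition minimal_distances (K : choiceType) (H : set {mset K}) : set nat :=
  [set d | exists2 S, divisor_closed H S & least (monoid_distances S) d].

Definition periodic (D : set int) (d : nat) : set int :=
  [set x | exists2 e, D e & exists k : int, x = e + d%:Z * k].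

Definition AAMP_with_period (d M : nat) (D : set int) (L : set int) : Prop :=
  exists (y : int) (L1 Ls L2 : set int) (mx : int),
  [/\ L = [set y + x | x in L1 `|` Ls `|` L2],
      (forall x, L x -> periodic D d (x - y)),
      [/\ finite_set Ls, least Ls 0, greatest Ls mx &
          Ls = periodic D d `&` [set x | 0 <= x <= mx]],
      L1 `<=` [set x | - M%:Z <= x <= -1] &
      L2 `<=` [set x | mx + 1 <= x <= mx + M%:Z]].

Definition AAMP (d M : nat) (L : set int) : Prop :=
  (0 < d)%N /\
  exists D : set int,
    [/\ D 0, D d%:Z, D `<=` [set x | 0 <= x <= d%:Z] &
        AAMP_with_period d M D L].

Section ZeroSum.
Variable G : zmodType.

Definition squarefree (S : {mset G}) : Prop := forall g, (S g <= 1)%N.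

Definition zero_sum : set {mset G} := [set S : {mset G} | \sum_(g <- S) g = 0].

(* If G has at most two elements, this monoid is factorial: its sets of lengths
   are singletons and it has no minimal distances. *)
Definition pm_zero_sum : set {mset G} :=
  [set S : {mset G} | exists eps : nat -> int,
     (forall i, eps i = 1 \/ eps i = -1) /\
     \sum_(i < size S) (S : seq G)`_i *~ eps i = 0].

End ZeroSum.

Arguments zero_sum : clear implicits.
Arguments pm_zero_sum : clear implicits.

(* Main.v *)
Require Import Defs.
From mathcomp Require Import all_boot all_order all_algebra.
From mathcomp Require Import finmap multiset.
From mathcomp Require Import boolp classical_sets functions cardinality.
From mathcomp Require Import zify ring.

(* Finite groups.  The monoid B_pm(G) has finitely many atoms, so factorizations
   are vectors in N^I with I the set of atoms.  By Dickson's lemma, tuples of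
   factorizations of a common element are sums of copies of finitely many
   generating tuples.  Apply this to a tuple that contains, for a given element,
   a shortest factorization, a longest one, and one for each residue class of
   lengths modulo a common multiple E of the minimal distances.  The generators
   that occur often span a divisor-closed submonoid; let d be its minimal
   distance.  Exchanging the entries of these generators copy by copy moves a
   factorization of any residue class modulo d from near the minimal to near the
   maximal length, and a bounded number of reserved copies supplies the steps of
   size d in between.  So the set of lengths is d-periodic away from its ends.

   Infinite groups.  Let the wanted factorization lengths be l_1, ..., l_N.  The
   terms of S are indexed by the choice functions V = prod_i [1, l_i] and are as
   generic as possible subject to the condition that each slice {v : v_i = r}
   has sum zero; each i then gives a factorization into l_i slices.  A subset
   with a vanishing signed sum is the support of a function that is a sum of
   functions of single coordinates, modulo p if G has infinitely many elements
   of prime order p, and over Z if there is no such p.  As soon as three such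
   supports are disjoint, all of them depend on the same single coordinate.
   Hence a factorization of length at least 3 is one of the prescribed ones, and
   only length 2 can have additional factorizations.  This settles min L = 2; in
   general one adds min L - 2 generic atoms x, y, -x-y. *)

Set Implicit Arguments.
Unset Strict Implicit.
Unset Printing Implicit Defensive.

Import GRing.Theory.

Local Open Scope mset_scope.
Local Open Scope classical_set_scope.
Local Open Scope card_scope.
Local Open Scope nat_scope.

(** * Dickson's lemma, weighted lengths, and bounded greedy representations *)

(** Induction on the list of coordinates. Let [F] be a finite dominating family for the remaining
    coordinates and [m] the largest [j]-coordinate in it. Elements with [j]-coordinate at least [m]
    are dominated by [F]; the others lie in the [m] slices of constant [j]-coordinate, each of which
    has its own finite family. *)
Lemma dickson (T J : eqType) (v : T -> J -> nat) (s : seq J) (A : set T) :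
  exists F : seq T, (forall f, f \in F -> A f) /\
    forall a, A a -> exists2 f, f \in F & forall j, j \in s -> v f j <= v a j.
Proof.
elim: s A => [|j s IH] A.
  have [[a Aa]|nA] := pselect (A !=set0); last first.
    by exists [::]; split=> // a Aa; case: nA; exists a.
  exists [:: a]; split=> [f|b _]; first by rewrite inE => /eqP ->.
  by exists a; rewrite ?mem_head.
have [F [FA Fmin]] := IH A.
have /choice[Fi HFi] := fun i => IH (A `&` [set a | v a j = i]).
pose m := \max_(f <- F) v f j.
exists (F ++ flatten [seq Fi i | i <- iota 0 m]); split=> [f|a Aa].
  rewrite mem_cat => /orP[/FA//|/flattenP[_ /mapP[i _ ->]]].
  by move=> /(HFi i).1[].
have [lem|ltm] := leqP m (v a j).
  have [f fF fmin] := Fmin a Aa; exists f; first by rewrite mem_cat fF.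
  move=> i; rewrite inE => /predU1P[->|/fmin//].
  by apply: leq_trans lem; rewrite /m (big_rem f) //= leq_maxl.
have [f fF fmin] := (HFi (v a j)).2 a (conj Aa erefl).
exists f.
  rewrite mem_cat; apply/orP; right; apply/flattenP; exists (Fi (v a j)) => //.
  by apply/mapP; exists (v a j); rewrite // mem_iota.
move=> i; rewrite inE => /predU1P[->|/fmin//].
by have [_ /= ->] := (HFi (v a j)).1 f fF.
Qed.

Lemma mulrn_nat (x n : nat) : (x *+ n)%R = n * x.
Proof. by rewrite -mulr_natl natn. Qed.

Section WeightedLength.
Variables (I : finType) (wt : I -> nat).
Implicit Types z w : {ffun I -> nat}.

(** A vector [z] is read as a multiset of atoms. Weight 1 gives its length as a factorization, the
    multiplicity of [x] in an atom gives the multiplicity of [x] in the product, and the size of an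
    atom gives the size of the product. *)
Definition wlen z := \sum_e wt e * z e.

Lemma wlenD z w : wlen (z + w)%R = wlen z + wlen w.
Proof.
by rewrite -big_split; apply: eq_bigr => e _; rewrite ffunE mulnDr.
Qed.

Lemma wlen0 : wlen 0%R = 0.
Proof. by rewrite /wlen big1 // => e _; rewrite ffunE muln0. Qed.

Lemma wlenMn z n : wlen (z *+ n)%R = n * wlen z.
Proof.
elim: n => [|n IH]; first by rewrite mulr0n wlen0.
by rewrite mulrS wlenD IH mulSn.
Qed.

Lemma wlen_sum (J : Type) (r : seq J) (P : pred J) (F : J -> {ffun I -> nat}) :
  wlen (\sum_(j <- r | P j) F j)%R = \sum_(j <- r | P j) wlen (F j).
Proof. exact: (big_morph wlen wlenD wlen0). Qed.

End WeightedLength.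

Notation len := (wlen (fun=> 1)).

(* Gordan's lemma; the generators are the minimal nonzero elements. *)
Lemma subtractive_fin_gen (J : finType) (E : set {ffun J -> nat}) :
  (forall a b, E a -> E (a + b)%R -> E b) ->
  exists (r : nat) (u : 'I_r -> {ffun J -> nat}), (forall j, E (u j)) /\
    forall w, E w -> exists n : 'I_r -> nat, w = (\sum_j u j *+ n j)%R.
Proof.
move=> Esub.
have [F [FE Fmin]] := @dickson _ _ (fun (f : {ffun J -> nat}) j => f j)
  (enum J) (E `&` [set w | w <> 0%R]).
exists (size F), (fun j => nth 0%R F j); split=> [j|w].
  by have [] := FE _ (mem_nth 0%R (ltn_ord j)).
have [m] := ubnP (len w); elim: m w => // m IH w; rewrite ltnS => lew Ew.
have [->|w0] := pselect (w = 0%R).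
  by exists (fun=> 0); rewrite big1 // => j _; rewrite mulr0n.
have [f fF lefw] := Fmin w (conj Ew w0).
have [Ef /= f0] := FE f fF.
pose w' := [ffun e => w e - f e] : {ffun J -> nat}.
have defw : w = (f + w')%R.
  by apply/ffunP => e; rewrite !ffunE; rewrite natrDE subnKC // lefw ?mem_enum.
have lenf : 0 < len f.
  rewrite lt0n; apply/eqP => lf; apply: f0; apply/ffunP => e; rewrite ffunE.
  move: lf => /eqP; rewrite /wlen sum_nat_eq0 => /forallP/(_ e).
  by rewrite mul1n => /eqP.
have Ew' : E w' by apply: (Esub f); rewrite -?defw.
have [|n defw'] := IH w' _ Ew'.
  by move: lew; rewrite {1}defw wlenD; lia.
have jP : index f F < size F by rewrite index_mem.
exists (fun j => (j == Ordinal jP) + n j).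
under eq_bigr do rewrite mulrnDr.
rewrite big_split /= -defw' (bigD1 (Ordinal jP)) //= eqxx mulr1n nth_index //.
by rewrite big1 ?addr0 // => j /negPf->; rewrite mulr0n.
Qed.

Lemma modn_sum (J : Type) (r : seq J) (P : pred J) (F G : J -> nat) d :
  (forall j, P j -> F j = G j %[mod d]) ->
  \sum_(j <- r | P j) F j = \sum_(j <- r | P j) G j %[mod d].
Proof.
move=> FG; rewrite -[LHS]modn_summ -[RHS]modn_summ.
by congr (_ %% _); apply: eq_bigr.
Qed.

(** Take the steps in the order of [r] until all copies of the next step together would reach [x].
    What is left after division by that step is smaller than the step, hence at most [c]. *)
Lemma greedy_sum (J : eqType) (r : seq J) (delta N : J -> nat) (c x : nat) :
  uniq r -> (forall j, j \in r -> delta j <= c) ->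
  x <= \sum_(j <- r) N j * delta j ->
  exists (m : J -> nat) (y : nat),
    [/\ forall j, m j <= N j, y <= c & x = \sum_(j <- r) m j * delta j + y].
Proof.
elim: r x => [|j r IH] x /=.
  rewrite big_nil leqn0 => _ _ /eqP->; exists (fun=> 0), 0.
  by rewrite big_nil.
move=> /andP[jr ur] hc; rewrite big_cons => lex.
have dc := hc j (mem_head _ _).
have [lx|gx] := leqP x (N j * delta j).
  (* If [delta j] is 0 then [x] is 0 here, and the convention that division by 0 gives 0 makes the
     same witnesses valid. *)
  exists (fun i => if i == j then x %/ delta j else 0), (x %% delta j); split.
  - move=> i; case: eqP => // ->; have [->|d0] := posnP (delta j).
      by rewrite divn0.
    by rewrite -[leqRHS](mulnK _ d0) leq_div2r.
  - have [d0|d0] := posnP (delta j); last by have := ltn_pmod x d0; lia.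
    by move: lx; rewrite d0 muln0 leqn0 => /eqP->; rewrite mod0n.
  - rewrite big_cons eqxx big_seq big1 ?addn0; first exact: divn_eq.
    by move=> i ir; case: eqP => // ij; rewrite -ij ir in jr.
have [||m [y [mN yc defx]]] := IH (x - N j * delta j) ur.
- by move=> i ir; apply: hc; rewrite inE ir orbT.
- by lia.
exists (fun i => if i == j then N j else m i), y; split=> //.
  by move=> i; case: eqP => [->|].
rewrite big_cons eqxx big_seq (eq_bigr (fun i => m i * delta i)); last first.
  by move=> i ir; case: eqP => // ij; rewrite -ij ir in jr.
by rewrite -big_seq -addnA -defx subnKC // ltnW.
Qed.

(** * Cancellative congruences on N^I *)

Section CancellativeCongruence.
Variables (I : finType) (wt : I -> nat).
Let V := {ffun I -> nat}.
Variable eqv : V -> V -> Prop.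
Hypothesis wt_gt0 : forall e, 0 < wt e.
Hypothesis eqv_refl : forall x, eqv x x.
Hypothesis eqv_sym : forall x y, eqv x y -> eqv y x.
Hypothesis eqv_trans : forall y x z, eqv x y -> eqv y z -> eqv x z.
Hypothesis eqvD : forall x y x' y', eqv x y -> eqv x' y' -> eqv (x + x')%R (y + y')%R.
Hypothesis eqv_cancel : forall x y z, eqv (x + y)%R (x + z)%R -> eqv y z.
Hypothesis eqv_wt : forall x y, eqv x y -> wlen wt x = wlen wt y.

(** As [wlen wt] is constant on classes, this bounds all lengths in a class, so that a longest
    factorization exists. *)
Lemma len_le_wlen z : len z <= wlen wt z.
Proof. by apply: leq_sum => e _; rewrite leq_mul2r wt_gt0 orbT. Qed.

Lemma eqvMn x y n : eqv x y -> eqv (x *+ n)%R (y *+ n)%R.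
Proof.
by move=> xy; elim: n => [|n IH]; rewrite ?mulr0n ?mulrS //; apply: eqvD.
Qed.

Lemma eqv_sum (J : Type) (r : seq J) (P : pred J) (F G : J -> V) :
  (forall j, P j -> eqv (F j) (G j)) ->
  eqv (\sum_(j <- r | P j) F j)%R (\sum_(j <- r | P j) G j)%R.
Proof. by move=> FG; apply: big_ind2 => // *; apply: eqvD. Qed.

Definition indic (A : {set I}) : V := [ffun e => nat_of_bool (e \in A)].

(* [face A] is the divisor-closed submonoid generated by the atoms in [A]. *)
Definition face (A : {set I}) (z : V) : Prop :=
  exists (n : nat) (w : V), eqv (z + w)%R (indic A *+ n)%R.

Lemma face0 A : face A 0%R.
Proof. by exists 0, 0%R; rewrite mulr0n addr0. Qed.

Lemma faceD A x y : face A x -> face A y -> face A (x + y)%R.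
Proof.
move=> [n [w xw]] [m [v yv]]; exists (n + m), (w + v)%R.
by rewrite mulrnDr addrACA; apply: eqvD.
Qed.

Lemma faceMn A x n : face A x -> face A (x *+ n)%R.
Proof.
move=> fx; elim: n => [|n IH]; rewrite ?mulr0n ?mulrS.
  exact: face0.
exact: faceD.
Qed.

Lemma face_sum A (J : Type) (r : seq J) (P : pred J) (F : J -> V) :
  (forall j, P j -> face A (F j)) -> face A (\sum_(j <- r | P j) F j)%R.
Proof.
move=> fF; apply: big_ind => //; [exact: face0 | exact: faceD].
Qed.

Lemma face_eqv A x y : eqv x y -> face A x -> face A y.
Proof.
move=> xy [n [w h]]; exists n, w; apply: eqv_trans h.
by apply: eqvD => //; apply: eqv_sym.
Qed.

Lemma face_supp (A : {set I}) (x : V) : (forall e, 0 < x e -> e \in A) -> face A x.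
Proof.
move=> xA; pose n := \sum_e x e.
have xn e : x e <= n by rewrite /n (bigD1 e) //= leq_addr.
pose y : V := [ffun e => n * (e \in A) - x e].
exists n, y; suff -> : (x + y)%R = (indic A *+ n)%R by [].
apply/ffunP => e; rewrite !ffunE ffunMnE ffunE mulrn_nat natrDE subnKC //.
case: (posnP (x e)) => [->//|/xA->]; by rewrite muln1.
Qed.

(** Arbitrary, not only adjacent, lengths are compared. The least difference is still the minimal
    distance, because a length strictly in between would produce a smaller difference. *)
Definition diffs A d : Prop :=
  0 < d /\ exists x y, [/\ face A x, eqv x y & len y = len x + d].

Definition min_diff A d : Prop :=
  diffs A d /\ forall d', diffs A d' -> d <= d'.

Lemma min_diff_unique A d d' : min_diff A d -> min_diff A d' -> d = d'.
Proof.
move=> [hd md] [hd' md']; apply/eqP.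
by rewrite eqn_leq md // md'.
Qed.

Lemma min_diff_exists A d : diffs A d -> exists d', min_diff A d'.
Proof.
move=> hd; have ex : exists n, `[< diffs A n >] by exists d; apply/asboolP.
have [m /asboolP hm mm] := ex_minnP ex.
by exists m; split=> // d' /asboolP; apply: mm.
Qed.

(** Let [b], [c] realize [d], and let [t] be the difference of the two lengths, with quotient [q] by
    [d]. Then [x + q c] and [y + q b] are equivalent and their lengths differ by the remainder of
    [t], which must vanish by minimality of [d]. *)
Lemma min_diff_mod A d x y :
  min_diff A d -> face A x -> eqv x y -> len x = len y %[mod d].
Proof.
move=> hd; wlog lexy : x y / len x <= len y => [wl fx xy|].
  have [|/ltnW] := leqP (len x) (len y); first by move=> /wl; apply.
  move=> /wl/(_ (face_eqv xy fx) (eqv_sym xy)); exact: esym.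
move=> fx xy; have [[d0 [b [c [fb bc lc]]]] dmin] := hd.
apply/esym/eqP; rewrite eqn_mod_dvd //; apply/negPn/negP => nd.
set t := len y - len x in nd.
suff /dmin : diffs A (t %% d) by have := ltn_pmod t d0; lia.
split; first by rewrite lt0n -/(d %| t).
exists (x + c *+ (t %/ d))%R, (y + b *+ (t %/ d))%R; split.
- by apply: faceD => //; apply: faceMn; apply: face_eqv fb.
- by apply: eqvD => //; apply: eqvMn; apply: eqv_sym.
- rewrite !wlenD !wlenMn lc; have := divn_eq t d.
  have : len y = len x + t by rewrite subnKC.
  by move: (t %/ d) (t %% d) => q r -> ->; lia.
Qed.

(** A cofactor completes the pair that realizes [d] to a power of [indic A], and further copies of
    [indic A] reach every larger power. *)
Lemma min_diff_power A d : min_diff A d -> exists N0, forall N, N0 <= N ->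
  exists b c, [/\ eqv b (indic A *+ N)%R, eqv c (indic A *+ N)%R &
                 len c = len b + d].
Proof.
move=> [[_ [b [c [[n [w bw]] bc lc]]]] _]; exists n => N nN.
pose v := (w + indic A *+ (N - n))%R.
have bv : eqv (b + v)%R (indic A *+ N)%R.
  by rewrite addrA -{2}(subnKC nN) mulrnDr; apply: eqvD.
exists (b + v)%R, (c + v)%R; split=> //; last by rewrite !wlenD lc; lia.
by apply: eqv_trans bv; apply: eqvD => //; apply: eqv_sym.
Qed.

Lemma min_diff_power_uniform : exists N, 0 < N /\ forall A d, min_diff A d ->
  exists b c, [/\ eqv b (indic A *+ N)%R, eqv c (indic A *+ N)%R &
                 len c = len b + d].
Proof.
have /choice[N0 hN0] : forall A, exists N0, forall d, min_diff A d ->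
    forall N, N0 <= N ->
  exists b c, [/\ eqv b (indic A *+ N)%R, eqv c (indic A *+ N)%R &
                 len c = len b + d].
  move=> A; have [[d hd]|nd] := pselect (exists d, min_diff A d).
    have [N0 hN0] := min_diff_power hd; exists N0 => d' hd'.
    by rewrite -(min_diff_unique hd hd').
  by exists 0 => d hd; case: nd; exists d.
exists (\sum_A N0 A).+1; split=> // A d hd.
by apply: hN0 hd _ _; rewrite (bigD1 A) //= -addnS leq_addr.
Qed.

Lemma min_diff_common_multiple :
  exists2 E, 0 < E & forall A d, min_diff A d -> d %| E.
Proof.
have /choice[D hD] : forall A, exists D, 0 < D /\ forall d, min_diff A d -> d = D.
  move=> A; have [[d hd]|nd] := pselect (exists d, min_diff A d).
    exists d; split=> [|d' hd']; first by case: hd => -[].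
    exact: min_diff_unique hd' hd.
  (* The value 1 for sets without differences keeps the product over all [A] positive. *)
  by exists 1; split=> // d hd; case: nd; exists d.
exists (\prod_A D A); first by apply/prodn_gt0 => A; case: (hD A).
by move=> A d /((hD A).2)->; rewrite (bigD1 A) //= dvdn_mulr.
Qed.

(** Replacing [b] by [c] in one of the [q] copies of [P] climbs one rung of height [d]. *)
Lemma ladder P b c d q i : eqv b P -> eqv c P -> len c = len b + d -> i <= q ->
  exists2 z, eqv z (P *+ q)%R & len z = q * len b + d * i.
Proof.
move=> bP cP lc iq; exists (b *+ (q - i) + c *+ i)%R.
  by rewrite -{2}(subnK iq) mulrnDr; apply: eqvD; apply: eqvMn.
rewrite wlenD !wlenMn lc -{2}(subnK iq); lia.
Qed.

(** * Exchanging the columns of frequent generators *)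

Section Center.
Variables (K : finType) (r N : nat) (u : 'I_r -> K -> V).
Hypothesis u_eqv : forall j i i', eqv (u j i) (u j i').
Hypothesis N_gt0 : 0 < N.
Hypothesis N_power : forall A d, min_diff A d ->
  exists b c, [/\ eqv b (indic A *+ N)%R, eqv c (indic A *+ N)%R &
                 len c = len b + d].

(** [U] exceeds the total weight of one copy of every generator. [R] is the number of reserved
    copies: by equivalence of the columns, [R] copies of one column amount to [N * U] copies of the
    sum of all [#|K|] columns, enough for [U] ladders over the [N]-th power of [indic A]. *)
Let U := (\sum_j \sum_i wlen wt (u j i)).+1.
Let R := #|K| * (N * U).

Lemma sum_wlen_col i : \sum_j wlen wt (u j i) <= U.
Proof.
by apply/ltnW; rewrite ltnS; apply: leq_sum => j _; rewrite (bigD1 i) //= leq_addr.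
Qed.

Lemma sum_len_col (P : pred 'I_r) (m : 'I_r -> nat) (c : nat) i :
  (forall j, P j -> m j <= c) -> \sum_(j | P j) m j * len (u j i) <= c * U.
Proof.
move=> mc; apply: leq_trans (leq_mul (leqnn c) (sum_wlen_col i)).
rewrite big_distrr /= [leqRHS](bigID P) /=; apply: leq_trans (leq_addr _ _).
by apply: leq_sum => j /mc mj; rewrite leq_mul // len_le_wlen.
Qed.

Variables (n : 'I_r -> nat).
Let z i : V := (\sum_j u j i *+ n j)%R.
Let big : pred 'I_r := fun j => R <= n j.
Let A : {set I} := [set e | [exists j, big j && [exists i, 0 < u j i e]]].

Lemma len_col i : len (z i) =
  \sum_(j | ~~ big j) n j * len (u j i) + \sum_(j | big j) n j * len (u j i).
Proof.
rewrite /z wlen_sum (bigID big) addnC /=.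
by congr (_ + _); apply: eq_bigr => j _; rewrite wlenMn.
Qed.

Lemma face_big j i : big j -> face A (u j i).
Proof.
move=> bj; apply: face_supp => e ue; rewrite inE; apply/existsP; exists j.
by rewrite bj; apply/existsP; exists i.
Qed.

(** A frequent generator that is longer in column [imax] than in [imin] would be a difference in the
    face. So only the rare generators can add length, and fewer than [R] copies of each occur. *)
Lemma bounded_if_no_diffs imin imax :
  (forall d, ~ diffs A d) -> len (z imax) <= len (z imin) + 2 * (R * U).
Proof.
move=> nd; rewrite !len_col.
have lebig : \sum_(j | big j) n j * len (u j imax) <= \sum_(j | big j) n j * len (u j imin).
  apply: leq_sum => j bj; rewrite leq_mul2l; apply/orP; right.
  rewrite leqNgt; apply/negP => lt; apply: (nd (len (u j imax) - len (u j imin))).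
  split; first by rewrite subn_gt0.
  exists (u j imin), (u j imax); split; [exact: face_big | exact: u_eqv |].
  by rewrite subnKC // ltnW.
have : \sum_(j | ~~ big j) n j * len (u j imax) <= R * U.
  by apply: sum_len_col => j; rewrite -ltnNge => /ltnW.
lia.
Qed.

(* [R] copies of every frequent generator are set aside: rewritten through the
   face [A] they provide all steps [0, d, ..., U * d], and these fill the gaps
   left when the remaining copies are moved one by one from column [imin] to
   column [imax]. *)
Lemma center_column d imin imax i0 x :
  min_diff A d -> (forall j, 0 < n j -> len (u j imin) <= len (u j imax)) ->
  len (z imin) + 2 * (R * U) <= x -> x + 2 * (R * U) <= len (z imax) ->
  x = len (z i0) %[mod d] -> exists2 z', eqv z' (z i0) & len z' = x.
Proof.
move=> hd lemm minx xmax xz.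
have d_gt0 : 0 < d by case: hd => -[].
have K_gt0 : 0 < #|K| by apply/card_gt0P; exists i0.
have R_gt0 : 0 < R by rewrite !muln_gt0 K_gt0 N_gt0.
have [b [c [bA cA lc]]] := N_power hd.
(* Every atom of [A] occurs in [Q], so [indic A] splits off. In [Q *+ (N * U)], which is equivalent
   to the reserve [P], the part over [indic A] is then replaced by a rung of the ladder. *)
pose Q := (\sum_(j | big j) \sum_i u j i)%R.
pose rest : V := [ffun e => Q e - indic A e].
have Qrest : Q = (indic A + rest)%R.
  apply/ffunP => e; rewrite !ffunE natrDE subnKC //.
  case: (boolP (e \in A)) => //; rewrite inE => /existsP[j /andP[bj /existsP[i ue]]].
  rewrite /Q sum_ffunE (bigD1 j) //= sum_ffunE (bigD1 i) //= natrDE.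
  by rewrite -addnA addn_gt0 ue.
pose P := (\sum_(j | big j) u j i0 *+ R)%R.
have QP : eqv (Q *+ (N * U))%R P.
  rewrite /P sumrMnl /R [X in eqv _ X]mulrnA; apply: eqvMn; rewrite -sumrMnl.
  apply: eqv_sum => j _; rewrite -sumr_const; apply: eqv_sum => i _.
  exact: u_eqv.
pose r0 := U * len b + len (rest *+ (N * U))%R.
have reserve i : i <= U -> exists2 y, eqv y P & len y = r0 + d * i.
  move=> iU; have [y yA ly] := ladder bA cA lc iU.
  exists (y + rest *+ (N * U))%R; last by rewrite wlenD ly /r0; lia.
  apply: eqv_trans QP; rewrite Qrest mulrnDl mulrnA; exact: eqvD.
have faceP : face A P.
  by apply: face_sum => j bj; apply: faceMn; apply: face_big.
have [y0 y0P ly0] := reserve 0 (leq0n _); rewrite muln0 addn0 in ly0.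
have lP : len P = \sum_(j | big j) R * len (u j i0).
  by rewrite /P wlen_sum; apply: eq_bigr => j _; rewrite wlenMn.
have r0_le : r0 <= R * U.
  rewrite -ly0; apply: leq_trans (len_le_wlen _) _; rewrite (eqv_wt y0P).
  rewrite wlen_sum; under eq_bigr do rewrite wlenMn.
  rewrite -big_distrr leq_mul2l; apply/orP; right.
  apply: leq_trans (sum_wlen_col i0).
  by rewrite [leqRHS](bigID big) leq_addr.
have lPr0 : len P = r0 %[mod d].
  by rewrite -ly0; apply: (min_diff_mod hd faceP); apply: eqv_sym.
pose small := \sum_(j | ~~ big j) n j * len (u j i0).
pose al j := len (u j imin); pose be j := len (u j imax).
have small_le : small <= R * U.
  by apply: sum_len_col => j; rewrite -ltnNge => /ltnW.
(* The starting length: rare generators in column [i0], unreserved copies of frequent ones in column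
   [imin], the reserve on its lowest rung. Both [small] and [r0] are at most [R * U]; the margin in
   the lower hypothesis pays for them. *)
pose C0 := small + \sum_(j | big j) (n j - R) * al j + r0.
have nR (F : 'I_r -> nat) : \sum_(j | big j) n j * F j =
    \sum_(j | big j) (n j - R) * F j + \sum_(j | big j) R * F j.
  by rewrite -big_split; apply: eq_bigr => j bj; rewrite /= -mulnDl subnK.
have C0x : C0 <= x.
  apply: leq_trans minx; rewrite len_col (nR al) /C0.
  lia.
have big_al_be j : big j -> al j <= be j.
  by move=> bj; apply: lemm; apply: leq_trans bj.
pose de j := be j - al j.
have xC0 : x - C0 <= \sum_(j | big j) (n j - R) * de j.
  have := xmax; rewrite len_col (nR be).
  have -> : \sum_(j | big j) (n j - R) * be j =
    \sum_(j | big j) (n j - R) * al j + \sum_(j | big j) (n j - R) * de j.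
    by rewrite -big_split; apply: eq_bigr => j bj; rewrite /= -mulnDr subnKC // big_al_be.
  have s1 : \sum_(j | ~~ big j) n j * len (u j imax) <= R * U.
    by apply: sum_len_col => j; rewrite -ltnNge => /ltnW.
  have s2 : \sum_(j | big j) R * be j <= R * U by apply: (@sum_len_col big (fun=> R)).
  rewrite /C0; lia.
have dde j : big j -> d %| de j.
  move=> bj; rewrite /de -eqn_mod_dvd ?big_al_be //; apply/eqP/esym.
  by apply: (min_diff_mod hd (face_big _ bj)).
(* Modulo [d] a frequent generator has the same length in all columns, and [r0] is the length of
   [P]; so [C0] is congruent to the length of [z i0]. *)
have dxC0 : d %| x - C0.
  rewrite -eqn_mod_dvd //; apply/eqP; rewrite xz len_col (nR (fun j => len (u j i0))).
  rewrite -lP /C0 -addnA -/small -[LHS]modnDmr -[RHS]modnDmr; congr ((_ + _) %% _).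
  rewrite -[LHS]modnDmr lPr0 modnDmr -[LHS]modnDml -[RHS]modnDml; congr ((_ + _) %% _).
  apply: modn_sum => j bj; rewrite -[LHS]modnMmr -[RHS]modnMmr; congr ((_ * _) %% _).
  by apply: (min_diff_mod hd (face_big _ bj)).
(* [m j] unreserved copies of generator [j] move from column [imin] to [imax]. The remainder [y] is
   a multiple of [d] and at most [U], so it is a height that the reserve can supply. *)
have [|||m [y [mN yU defx]]] :=
    @greedy_sum _ [seq j <- enum 'I_r | big j] de (fun j => n j - R) U (x - C0).
- by rewrite filter_uniq // enum_uniq.
- move=> j _; apply: leq_trans (leq_subr _ _) _; apply: leq_trans (len_le_wlen _) _.
  by apply: leq_trans (sum_wlen_col imax); rewrite (bigD1 j) //= leq_addr.
- by rewrite big_filter big_enum_cond.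
rewrite big_filter big_enum_cond /= in defx.
have dy : d %| y.
  have := dxC0; rewrite defx dvdn_addr // dvdn_sum // => j bj.
  by rewrite dvdn_mull // dde.
have [|y1 y1P ly1] := reserve (y %/ d).
  by apply: leq_trans yU; apply: leq_div.
exists ((\sum_(j | ~~ big j) u j i0 *+ n j) +
  \sum_(j | big j) (u j imin *+ (n j - R - m j) + u j imax *+ m j) + y1)%R.
  rewrite /z [X in eqv _ X](bigID big) /= [X in eqv _ X]addrC -addrA; apply: eqvD => //.
  have -> : (\sum_(j | big j) u j i0 *+ n j =
      \sum_(j | big j) u j i0 *+ (n j - R) + P)%R.
    by rewrite -big_split; apply: eq_bigr => j bj; rewrite /= -mulrnDr subnK.
  apply: eqvD => //; apply: eqv_sum => j bj.
  rewrite -{2}(subnK (mN j)) mulrnDr.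
  by apply: eqvD; apply: eqvMn; apply: u_eqv.
rewrite !wlenD ly1 !wlen_sum [d * _]mulnC divnK //.
rewrite -(subnKC C0x) defx /C0 /small.
under eq_bigr do rewrite wlenMn.
have -> : \sum_(j | big j) len (u j imin *+ (n j - R - m j) + u j imax *+ m j)%R =
    \sum_(j | big j) (n j - R) * al j + \sum_(j | big j) m j * de j.
  rewrite -big_split; apply: eq_bigr => j bj; rewrite /= wlenD !wlenMn -/(al j) -/(be j).
  rewrite -(subnKC (big_al_be j bj)) -/(de j) -{2}(subnK (mN j)).
  lia.
rewrite -[LHS]addnA -[RHS]addnA -[RHS]addnA; congr (_ + _).
by rewrite -[LHS]addnA; congr (_ + _); exact: addnCA.
Qed.

End Center.

(** [M] is determined by the generating tuples alone; only the set [A] of atoms in frequent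
    generators depends on [z]. The first alternative is the case in which the face of [A] has no
    differences. *)
Theorem lengths_periodic_center : exists M E : nat, 0 < E /\ forall z : V,
  (forall x y, eqv x z -> eqv y z -> len y <= len x + M) \/
  exists A d, [/\ min_diff A d, d <= E & forall x y w l,
    eqv x z -> eqv y z -> eqv w z -> len x + M <= l -> l + M <= len y ->
    l = len w %[mod d] -> exists2 z', eqv z' z & len z' = l].
Proof.
have [N [N_gt0 hN]] := min_diff_power_uniform.
have [E E_gt0 hE] := min_diff_common_multiple.
(* One column for each residue class of lengths modulo E, and two for the
   extreme lengths. *)
pose K := ('I_E + bool)%type.
pose col (w : {ffun K * I -> nat}) (i : K) : V := [ffun e => w (i, e)].
have colD x y i : col (x + y)%R i = (col x i + col y i)%R.
  by apply/ffunP => e; rewrite !ffunE.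
have [|r [u [ueqv ugen]]] := @subtractive_fin_gen _
    (fun w => forall i i', eqv (col w i) (col w i')).
  move=> a b ha hab i i'; apply: (@eqv_cancel (col a i)); rewrite -colD.
  by apply: eqv_trans (hab i i') _; rewrite colD; apply: eqvD.
pose U := (\sum_j \sum_i wlen wt (col (u j) i)).+1.
pose M := 2 * (#|{: K}| * (N * U) * U).
exists M, E; split=> // z.
have ex_len : exists l, `[< exists2 x, eqv x z & len x = l >].
  by exists (len z); apply/asboolP; exists z.
have ub_len l : `[< exists2 x, eqv x z & len x = l >] -> l <= wlen wt z.
  by move=> /asboolP[x /eqv_wt <- <-]; apply: len_le_wlen.
have [_ /asboolP[zmin zminz <-] hmin] := ex_minnP ex_len.
have [_ /asboolP[zmax zmaxz <-] hmax] := ex_maxnP ex_len ub_len.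
have minP x : eqv x z -> len zmin <= len x.
  by move=> xz; apply: hmin; apply/asboolP; exists x.
have maxP x : eqv x z -> len x <= len zmax.
  by move=> xz; apply: hmax; apply/asboolP; exists x.
(* A residue class that contains no length of a factorization is filled with [z] itself; such a
   column is never chosen as [i0]. *)
have /choice[rep hrep] : forall c : 'I_E, exists x, eqv x z /\
    forall w, eqv w z -> len w = c %[mod E] -> len x = c %[mod E].
  move=> c; have [[x xz xc]|nx] := pselect (exists2 x, eqv x z & len x = c %[mod E]).
    by exists x.
  by exists z; split=> // w wz wc; case: nx; exists w.
pose colz (i : K) := match i with inl c => rep c | inr b => if b then zmax else zmin end.
have colzz i : eqv (colz i) z.
  by case: i => [c|[]] //=; case: (hrep c).
have [|n defw] := ugen [ffun p : K * I => colz p.1 p.2].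
  move=> i i'; have colE j : col [ffun p : K * I => colz p.1 p.2] j = colz j.
    by apply/ffunP => e; rewrite !ffunE.
  rewrite !colE; exact: eqv_trans (colzz i) (eqv_sym (colzz i')).
have colE i : colz i = (\sum_j col (u j) i *+ n j)%R.
  apply/ffunP => e; have /ffunP/(_ (i, e)) := defw; rewrite ffunE /= => ->.
  by rewrite !sum_ffunE; apply: eq_bigr => j _; rewrite !ffunMnE ffunE.
pose R := #|{: K}| * (N * U).
pose A := [set e | [exists j, (R <= n j) && [exists i, 0 < col (u j) i e]]]%SET.
have [[d0 hd0]|nd] := pselect (exists d, diffs A d); last first.
  left=> x y xz yz; apply: leq_trans (maxP _ yz) _.
  apply: leq_trans (leq_add (minP _ xz) (leqnn M)).
  have := @bounded_if_no_diffs _ r N (fun j => col (u j)) ueqv N_gt0 n (inr false) (inr true).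
  rewrite -!colE /=; apply => d hd; apply: nd; exists d; exact: hd.
have [d hd] := min_diff_exists hd0.
right; exists A, d; split=> //; first by rewrite dvdn_leq // (hE A d hd).
move=> x y w l xz yz wz xl ly lw.
pose i0 : K := inl (Ordinal (ltn_pmod (len w) E_gt0)).
(* Otherwise replacing one copy of generator [j] in [zmin] by its other column would give an
   equivalent vector shorter than the minimum. *)
have lenmin (j : 'I_r) : 0 < n j ->
    len (col (u j) (inr false)) <= len (col (u j) (inr true)).
  move=> nj; rewrite leqNgt; apply/negP => lt.
  pose rest : V := ((\sum_(k | k != j) col (u k) (inr false) *+ n k) +
    col (u j) (inr false) *+ (n j).-1)%R.
  have defmin : zmin = (col (u j) (inr false) + rest)%R.
    rewrite /rest addrCA -mulrS prednK // -[LHS]/(colz (inr false)) colE.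
    by rewrite (bigD1 j) //= addrC.
  have := minP (col (u j) (inr true) + rest)%R.
  rewrite defmin !wlenD leq_add2r leqNgt lt => /(_ _)/negP; apply=> //.
  by apply: eqv_trans zminz; rewrite defmin; apply: eqvD.
have := @center_column _ r N (fun j => col (u j)) ueqv N_gt0 hN n d
  (inr false) (inr true) i0 l hd lenmin.
rewrite -!colE /= => hc.
have [||| z' z'z lz'] := hc.
- by apply: leq_trans xl; rewrite leq_add2r minP.
- by apply: leq_trans ly _; apply: maxP.
- have dE : d %| E := hE A d hd.
  have lrep := (hrep (Ordinal (ltn_pmod (len w) E_gt0))).2 w wz.
  rewrite /= modn_mod in lrep.
  have := congr1 (modn^~ d) (lrep erefl); rewrite /= !(modn_dvdm _ dE) => ->.
  exact: lw.
exists z' => //; apply: eqv_trans z'z _; exact: (colzz i0).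
Qed.

End CancellativeCongruence.

(** * Almost arithmetic multiprogressions *)

Section AAMPCriteria.
Local Open Scope ring_scope.
Implicit Types (L : set nat) (lo hi d M E : nat).

Lemma int_setP L (x : int) : int_set L x <-> 0 <= x /\ L `|x|%N.
Proof.
split=> [[n Ln <-]|[x0 Lx]]; first by [].
by exists `|x|%N => //; rewrite gez0_abs.
Qed.

Lemma finite_int_range (a b : int) : finite_set [set x : int | a <= x <= b].
Proof.
apply: (@sub_finite_set _ _ [set a + i%:Z | i in `I_(`|b - a|%N.+1)]).
  by move=> x /= h; exists `|x - a|%N; lia.
by apply: finite_image; apply: finite_II.
Qed.

(** With the whole interval from 0 to [d] as period there is no congruence condition. The central
    part is the point [lo], and all other lengths go into the upper end part. *)
Lemma AAMP_of_bounded L lo hi d M :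
  (0 < d)%N -> L lo -> (forall l, L l -> lo <= l <= hi)%N -> (hi <= lo + M)%N ->
  AAMP d M (int_set L).
Proof.
move=> d0 Llo Lb hiM; split=> //.
exists [set x | 0 <= x <= d%:Z]; split=> //=; try lia.
exists lo%:Z, set0, [set 0], [set x | 1 <= x /\ int_set L (lo%:Z + x)], 0; split.
- rewrite set0U; apply/seteqP; split=> [x Lx|_ [x + <-]].
    have [x0 Lx'] := (int_setP _ _).1 Lx; have := Lb _ Lx' => h.
    exists (x - lo%:Z); last by lia.
    have [->|ne] := pselect (x = lo%:Z); first by left; rewrite subrr.
    by right; split; [lia | rewrite addrC subrK].
  by case=> [->|[_ //]]; rewrite addr0; apply/int_setP.
- move=> x _; exists ((x - lo%:Z) %% d%:Z)%Z.
    by rewrite /= modz_ge0 ?ltW ?ltz_pmod //; lia.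
  exists ((x - lo%:Z) %/ d%:Z)%Z; rewrite [RHS]addrC [X in _ = X + _]mulrC.
  exact: divz_eq.
- split; [exact: finite_set1 | | |].
  + by split=> // x /= ->.
  + by split=> // x /= ->.
  + apply/seteqP; split=> x /=; last by move=> [_]; lia.
    by move=> ->; split=> //; exists 0 => /=; [lia | exists 0; lia].
- by [].
- by move=> x /= [x1 /int_setP[x0 /Lb h]]; lia.
Qed.

Lemma modn_of_int_eq (l w d : nat) (k : int) :
  l%:Z = w%:Z + d%:Z * k -> l = w %[mod d].
Proof.
case: k => k h.
  have -> : l = (k * d + w)%N by lia.
  by rewrite modnMDl.
have -> : w = (k.+1 * d + l)%N by move: h; rewrite NegzE; lia.
by rewrite modnMDl.
Qed.

(** Either the whole set fits into the bound, or [M * d] is cut off at each end, which is at most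
    [M * E], and what remains is a union of residue classes. *)
Lemma AAMP_of_center L lo hi d M E :
  (0 < d)%N -> (d <= E)%N -> L lo -> L hi -> (forall l, L l -> lo <= l <= hi)%N ->
  (forall l w, L w -> lo + M <= l -> l + M <= hi -> l = w %[mod d] -> L l)%N ->
  AAMP d (2 * M * E) (int_set L).
Proof.
move=> d0 dE Llo Lhi Lb Lc.
have [small|large] := leqP hi (lo + 2 * M * E).
  exact: AAMP_of_bounded d0 Llo Lb small.
have MdE : (M * d <= M * E)%N by rewrite leq_mul2l dE orbT.
have Md : (M <= M * d)%N by rewrite leq_pmulr.
(* Cutting multiples of [d] rather than [M] keeps the ends of the central part in the classes of
   [lo] and [hi], so that 0 and [mx] belong to it. *)
pose y : int := lo%:Z + M%:Z * d%:Z; pose mx : int := hi%:Z - M%:Z * d%:Z - y.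
pose cong (x : int) := exists2 w, L w & exists k : int, y + x = w%:Z + d%:Z * k.
have congD x k : cong x -> cong (x + d%:Z * k).
  by move=> [w Lw [i hi']]; exists w => //; exists (i + k); lia.
pose D := [set e | 0 <= e <= d%:Z /\ cong e].
have cong0 : cong 0 by exists lo => //; exists M%:Z; rewrite /y; lia.
have congmx : cong mx by exists hi => //; exists (- M%:Z); rewrite /mx; lia.
have mx0 : 0 <= mx by rewrite /mx /y; lia.
have perD x : periodic D d x <-> cong x.
  split=> [[e [_ ce] [k ->]]|cx]; first exact: congD.
  exists (x %% d%:Z)%Z; last first.
    exists (x %/ d%:Z)%Z; rewrite [RHS]addrC [X in _ = X + _]mulrC.
    exact: divz_eq.
  split; first by rewrite modz_ge0 ?ltW ?ltz_pmod //; lia.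
  have -> : (x %% d%:Z)%Z = x + d%:Z * (- (x %/ d%:Z)%Z).
    by rewrite {2}(divz_eq x d%:Z); lia.
  exact: congD.
split=> //; exists D; split.
- by split=> //; lia.
- by split; [lia | rewrite -[d%:Z]add0r -[X in cong (_ + X)]mulr1; apply: congD].
- by move=> x [].
exists y, [set x | x < 0 /\ int_set L (y + x)],
  (periodic D d `&` [set x | 0 <= x <= mx]),
  [set x | mx < x /\ int_set L (y + x)], mx; split.
- apply/seteqP; split=> [x Lx|_ [x + <-]].
    exists (x - y); last by lia.
    have [x0|x0] := boolP (x - y < 0); first by left; left; rewrite /= [y + _]addrC subrK.
    have [xm|xm] := boolP (mx < x - y); first by right; rewrite /= [y + _]addrC subrK.
    left; right; split; last by rewrite /=; lia.
    have [z0 Lz] := (int_setP _ _).1 Lx.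
    by apply/perD; exists `|x|%N => //; exists 0; lia.
  case=> [[[]//|[/perD [w Lw [k hk]] /= bx]]|[]//].
  have yx : y + x = absz (y + x) by rewrite /y /= in bx *; lia.
  apply/int_setP; split; first by rewrite yx.
  apply: (Lc _ w) => //; try by rewrite /mx /y in bx hk *; lia.
  by apply: (@modn_of_int_eq _ _ _ k); rewrite -yx.
- move=> x /int_setP[x0 Lx]; apply/perD.
  by exists `|x|%N => //; exists 0; lia.
- split.
  + by apply: sub_finite_set (finite_int_range 0 mx) => x [].
  + by split=> [|x [_ /=]]; [split=> /=; [apply/perD | lia] | lia].
  + by split=> [|x [_ /=]]; [split=> /=; [apply/perD | lia] | lia].
  + by [].
- move=> x [x0 /int_setP[yx /Lb]]; rewrite /= /y in yx *; lia.
- move=> x [x0 /int_setP[yx /Lb]]; rewrite /= /mx /y in x0 yx *; lia.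
Qed.

End AAMPCriteria.

(** * Submonoids with finitely many atoms *)

Section MsetSums.
Variable K : choiceType.
Implicit Types (A B : {mset K}) (zz : {mset {mset K}}).

Lemma perm_msetD A B : perm_eq (A `+` B)%mset (A ++ B).
Proof.
by apply/allP => x _ /=; rewrite count_cat !count_mem_mset msetE2.
Qed.

Lemma perm_mset1 (a : K) : perm_eq [mset a]%mset [:: a].
Proof. by rewrite enum_msetn. Qed.

Lemma big_msetDE (R : Type) (idx : R) (op : Monoid.com_law idx) A B (F : K -> R) :
  \big[op/idx]_(x <- (A `+` B)%mset) F x =
    op (\big[op/idx]_(x <- A) F x) (\big[op/idx]_(x <- B) F x).
Proof. by rewrite (perm_big _ (perm_msetD A B)) big_cat. Qed.

Lemma big_mset1E (R : Type) (idx : R) (op : Monoid.com_law idx) a (F : K -> R) :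
  \big[op/idx]_(x <- [mset a]%mset) F x = F a.
Proof. by rewrite (perm_big _ (perm_mset1 a)) big_seq1. Qed.

Lemma big_msetD_app (I : Type) (s : seq I) (P : pred I) (F : I -> {mset K}) x :
  (\big[msetD/mset0]_(i <- s | P i) F i) x = \sum_(i <- s | P i) F i x.
Proof.
apply: (big_morph (fun A : {mset K} => A x)) => [A B|]; first by rewrite msetE2.
exact: mset0E.
Qed.

Lemma msetD_injl A : injective (msetD A).
Proof. exact: can_inj (msetDKB A). Qed.

Lemma size_msetD A B : size (A `+` B)%mset = size A + size B.
Proof. by rewrite (perm_size (perm_msetD A B)) size_cat. Qed.

Lemma size_mset1 (a : K) : size [mset a]%mset = 1.
Proof. by rewrite (perm_size (perm_mset1 a)). Qed.

Lemma mset_sum_uniq (M : nmodType) (s : seq K) A (F : K -> M) : uniq s -> (forall x, x \in A -> x \in s) ->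
  (\sum_(x <- A) F x = \sum_(x <- s) F x *+ A x)%R.
Proof.
move=> us As.
transitivity (\sum_(x <- A) \sum_(y <- s) F y *+ (y == x))%R.
  rewrite big_seq [RHS]big_seq; apply: eq_bigr => x /As xs.
  rewrite (bigD1_seq x) //= eqxx mulr1n big1 ?addr0 // => y yx.
  by rewrite (negPf yx) mulr0n.
rewrite exchange_big; apply: eq_bigr => y _ /=.
rewrite -count_mem_mset -sum1_count -sumrMnr [in RHS]big_mkcond /=.
by apply: eq_bigr => x _; rewrite eq_sym; case: eqP; rewrite ?mulr1n ?mulr0n.
Qed.

Lemma mset_supported_sum (I : finType) (f : I -> K) (F : K -> nat) A :
  injective f -> (forall x, x \in A -> exists i, f i = x) ->
  \sum_(x <- A) F x = \sum_i F (f i) * A (f i).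
Proof.
move=> finj Af; have us : uniq (map f (enum I)) by rewrite map_inj_uniq ?enum_uniq.
have As x : x \in A -> x \in map f (enum I).
  by move=> /Af[i <-]; rewrite map_f ?mem_enum.
apply: etrans (mset_sum_uniq F us As) _; rewrite big_map big_enum.
by apply: eq_bigr => i _; rewrite mulrn_nat mulnC.
Qed.

End MsetSums.

Section DivisorClosed.
Variable K : choiceType.
Implicit Types (H S : set {mset K}) (a b c u : {mset K}).

Lemma submonoid_big H (zz : seq {mset K}) : submonoid H ->
  (forall u, u \in zz -> H u) -> H (\big[msetD/mset0]_(u <- zz) u).
Proof.
move=> [H0 HD]; elim: zz => [|u zz IH] hz; first by rewrite big_nil.
rewrite big_cons; apply: HD; first by apply: hz; rewrite mem_head.
by apply: IH => v vz; apply: hz; rewrite inE vz orbT.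
Qed.

Lemma big_msetD_perm (s t : seq {mset K}) : perm_eq s t ->
  \big[msetD/mset0]_(u <- s) u = \big[msetD/mset0]_(u <- t) u.
Proof.
by move=> st; apply/msetP => x; rewrite !big_msetD_app (perm_big _ st).
Qed.

Lemma divisor_closed_atom H S u : divisor_closed H S -> S u ->
  atom S u <-> atom H u.
Proof.
move=> [_ SH Sdiv] Su; split=> [[_ u0 uat]|[_ u0 uat]].
  split=> // [|b c Hb Hc defu]; first exact: SH.
  apply: uat => //; apply: Sdiv Su _ _ => //; first by exists c.
  by exists b; rewrite // defu msetDC.
by split=> // b c /SH Hb /SH Hc; apply: uat.
Qed.

Lemma divisor_closed_factorizations H S a : submonoid H -> divisor_closed H S ->
  S a -> factorizations S a = factorizations H a.
Proof.
move=> mH dS Sa; have [_ SH Sdiv] := dS; apply/seteqP; split=> zz [zat defz].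
  by split=> // u /zat uS; apply/(divisor_closed_atom dS) => //; case: uS.
split=> // u uz; have uH := zat u uz.
apply/(divisor_closed_atom dS) => //; case: (uH) => Hu _ _.
pose rest := \big[msetD/mset0]_(v <- rem u (zz : seq {mset K})) v.
have defa : \big[msetD/mset0]_(v <- zz) v = (u `+` rest)%mset.
  by rewrite (big_msetD_perm (perm_to_rem uz)) big_cons.
have Hrest : H rest.
  by apply: submonoid_big => // v /mem_rem /zat[].
by apply: (Sdiv u _ Sa Hu); exists rest; rewrite // -defz.
Qed.

End DivisorClosed.

Section FinitelyManyAtoms.
Variables (K : choiceType) (H : set {mset K}).
Hypotheses (H_submonoid : submonoid H) (H_fin : finite_set (atom H)).

Lemma finite_atoms_seq : exists s : seq {mset K}, forall u, u \in s <-> atom H u.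
Proof.
have [s hs] := (finite_seqP _).1 H_fin; exists s => u.
by have /seteqP[h1 h2] := hs; split=> [/h2|/h1].
Qed.

Let s := projT1 (cid finite_atoms_seq).

Lemma mem_atoms u : u \in s <-> atom H u.
Proof. exact: (projT2 (cid finite_atoms_seq)). Qed.

Let I : finType := seq_sub s.
Let V := {ffun I -> nat}.

Definition mult_of (x : K) (e : I) : nat := val e x.

Lemma atom_val (e : I) : atom H (val e).
Proof. by apply/mem_atoms; exact: valP. Qed.

(** The dictionary between vectors over the finite set of atoms and multisets of atoms; [prodv]
    becomes a homomorphism onto [H], and its kernel is the congruence of the previous part. *)
Definition factn (z : V) : {mset {mset K}} :=
  seq_mset (flatten [seq nseq (z e) (val e) | e <- enum I]).

Definition prodv (z : V) : {mset K} := \big[msetD/mset0]_(u <- factn z) u.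

Lemma sum_factn (z : V) (F : {mset K} -> nat) :
  \sum_(u <- factn z) F u = \sum_e F (val e) * z e.
Proof.
rewrite (perm_big _ (perm_eq_seq_mset _)) big_flatten big_map big_enum /=.
by apply: eq_bigr => e _; rewrite big_nseq iter_addn_0.
Qed.

Lemma prodvE z x : prodv z x = wlen (mult_of x) z.
Proof. by rewrite /prodv big_msetD_app sum_factn. Qed.

Lemma size_factn z : size (factn z) = len z.
Proof. by rewrite -sum1_size sum_factn. Qed.

Lemma factn_atom z u : u \in factn z -> atom H u.
Proof.
rewrite (perm_mem (perm_eq_seq_mset _)) => /flattenP[_ /mapP[e _ ->]].
by move=> /nseqP[-> _]; exact: atom_val.
Qed.

Lemma prodv_in z : H (prodv z).
Proof. by apply: submonoid_big => // u /factn_atom[]. Qed.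

Lemma prodvD z w : prodv (z + w)%R = (prodv z `+` prodv w)%mset.
Proof. by apply/msetP => x; rewrite msetE2 !prodvE wlenD. Qed.

Lemma prodv0 : prodv 0%R = mset0.
Proof. by apply/msetP => x; rewrite mset0E prodvE wlen0. Qed.

Lemma lengthsP a n : lengths H a n <-> exists2 z, prodv z = a & len z = n.
Proof.
split=> [[zz [zat <-] <-]|[z <- <-]]; last first.
  by exists (factn z); [split=> //; exact: factn_atom | exact: size_factn].
have vi : injective (fun e : I => val e) := val_inj.
have zs u : u \in zz -> exists e : I, val e = u.
  by move=> /zat/mem_atoms us; exists (SeqSub us).
exists [ffun e => zz (val e)].
  apply/msetP => x; rewrite prodvE big_msetD_app.
  rewrite (mset_supported_sum (fun u : {mset K} => u x) vi zs).
  by apply: eq_bigr => e _; rewrite ffunE.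
rewrite -sum1_size (mset_supported_sum (fun=> 1) vi zs).
by apply: eq_bigr => e _; rewrite ffunE.
Qed.

Lemma prodv_surj a : H a -> exists z, prodv z = a.
Proof.
have [m] := ubnP (size a); elim: m a => // m IH a; rewrite ltnS => sa Ha.
have [->|a0] := pselect (a = mset0); first by exists 0%R; exact: prodv0.
have [aat|naat] := pselect (atom H a).
  suff /lengthsP[z <- _] : lengths H a 1 by exists z.
  exists [mset a]%mset; last by rewrite size_mset1.
  split=> [u|]; first by rewrite in_mset1 => /eqP->.
  by apply/msetP => x; rewrite big_msetD_app big_mset1E.
have [b [c [Hb Hc defa b0 c0]]] : exists b c, [/\ H b, H c, a = (b `+` c)%mset,
    b <> mset0 & c <> mset0].
  apply: contrapT => nbc; apply: naat; split=> // b c Hb Hc defa.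
  have [->|b0] := pselect (b = mset0); first by left.
  have [->|c0] := pselect (c = mset0); first by right.
  by case: nbc; exists b, c.
have pos (b' : {mset K}) : b' <> mset0 -> 0 < size b'.
  by move=> h; rewrite lt0n size_mset_eq0; apply/eqP.
have := pos _ b0; have := pos _ c0; have := sa; rewrite defa size_msetD => h1 h2 h3.
have [|z <-] := IH b _ Hb; first by lia.
have [|w <-] := IH c _ Hc; first by lia.
by exists (z + w)%R; rewrite prodvD.
Qed.

Let eqv (z w : V) := prodv z = prodv w.

Let X : seq K := undup (flatten [seq enum_mset u | u <- s]).
(** The size of the atom [e], written as a sum over [X] so that the weight of a vector is visibly a
    function of the multiplicities in its product. *)
Let wt (e : I) : nat := \sum_(x <- X) mult_of x e.

Lemma wt_pos e : 0 < wt e.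
Proof.
have [_ /eqP u0 _] := atom_val e; have [/eqP|[x xe]] := mset_0Vmem (val e).
  by rewrite (negPf u0).
have xX : x \in X.
  rewrite mem_undup; apply/flattenP; exists (enum_mset (val e)) => //.
  by apply/mapP; exists (val e) => //; exact: valP.
by rewrite /wt (big_rem x xX) /= addn_gt0 /mult_of -in_mset xe.
Qed.

Lemma prodv_wt z w : eqv z w -> wlen wt z = wlen wt w.
Proof.
move=> zw; have E y : wlen wt y = \sum_(x <- X) prodv y x.
  rewrite /wlen; under eq_bigr do rewrite /wt big_distrl.
  by rewrite exchange_big; apply: eq_bigr => x _; rewrite prodvE.
by rewrite !E zw.
Qed.

Lemma prodv_compat x y x' y' : eqv x y -> eqv x' y' -> eqv (x + x')%R (y + y')%R.
Proof. by rewrite /eqv !prodvD => -> ->. Qed.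

Lemma prodv_cancel x y z : eqv (x + y)%R (x + z)%R -> eqv y z.
Proof. by rewrite /eqv !prodvD => /msetD_injl. Qed.

Let eqv_refl x : eqv x x. Proof. by []. Qed.
Let eqv_sym x y : eqv x y -> eqv y x. Proof. exact: esym. Qed.
Let eqv_trans y x z : eqv x y -> eqv y z -> eqv x z. Proof. exact: etrans. Qed.

Definition face_monoid (A : {set I}) : set {mset K} :=
  [set a | exists2 z, prodv z = a & face eqv A z].

Lemma face_monoid_divisor_closed A : divisor_closed H (face_monoid A).
Proof.
split.
- split; first by exists 0%R; [exact: prodv0 | exact: face0].
  move=> _ _ [z <- fz] [w <- fw]; exists (z + w)%R; first exact: prodvD.
  exact: (faceD prodv_compat).
- by move=> _ [z <- _]; exact: prodv_in.
- move=> a b [zb <- fb] /prodv_surj[za <-] [c /prodv_surj[zc <-] defb].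
  exists za => //.
  have [n [w hw]] : face eqv A (za + zc)%R.
    apply: (face_eqv eqv_refl eqv_sym eqv_trans prodv_compat) fb.
    by rewrite /eqv defb prodvD.
  by exists n, (zc + w)%R; rewrite addrA.
Qed.

Lemma distance_diffs A d : monoid_distances (face_monoid A) d -> diffs eqv A d.
Proof.
move=> [a Sa [_ [_ [[m Lm <-] [n Ln <-] mn _ def_n]]]].
have [z0 defa fz0] := Sa.
have eqL : lengths (face_monoid A) a = lengths H a.
  rewrite /lengths (@divisor_closed_factorizations _ H) //.
  exact: face_monoid_divisor_closed.
move: Lm Ln; rewrite eqL => /lengthsP[x xa lx] /lengthsP[y ya ly].
split; first by lia.
exists x, y; split; last by lia.
- apply: (face_eqv eqv_refl eqv_sym eqv_trans prodv_compat) fz0.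
  by rewrite /eqv defa xa.
- by rewrite /eqv xa ya.
Qed.

(** The witnesses of the least difference have adjacent lengths, since a length between them would
    give a smaller difference. Conversely every distance in the face monoid is a difference. *)
Lemma min_diff_minimal_distance A d :
  min_diff eqv A d -> minimal_distances H d.
Proof.
move=> [[d0 [x [y [fx xy lxy]]]] dmin].
exists (face_monoid A); first exact: face_monoid_divisor_closed.
split; last by move=> d' /distance_diffs; apply: dmin.
have Sx : face_monoid A (prodv x) by exists x.
have eqL : lengths (face_monoid A) (prodv x) = lengths H (prodv x).
  rewrite /lengths (@divisor_closed_factorizations _ H) //.
  exact: face_monoid_divisor_closed.
exists (prodv x) => //; rewrite eqL; exists (Posz (len x)), (Posz (len y)); split.
- by exists (len x) => //; apply/lengthsP; exists x.
- by exists (len y) => //; apply/lengthsP; exists y.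
- by lia.
- move=> _ [k /lengthsP[w wx lw] <-]; apply/negP => kb.
  suff /dmin : diffs eqv A (len w - len x) by lia.
  by split; [lia | exists x, w; split=> //; lia].
- by lia.
Qed.

(** All vectors lie in the face of all atoms. If that face has no differences, every set of lengths
    is a singleton; otherwise its minimal difference is available for elements whose lengths have
    bounded spread. *)
Theorem structure_of_lengths :
  (exists M, forall a, H a -> exists2 d, minimal_distances H d &
     AAMP d M (int_set (lengths H a))) \/
  (forall a, H a -> exists n, lengths H a = [set n]).
Proof.
have [M [E [E0 hM]]] := lengths_periodic_center wt_pos eqv_refl eqv_sym
  eqv_trans prodv_compat prodv_cancel prodv_wt.
have [[d0 hd0]|nd] := pselect (exists d, diffs eqv [set: I]%SET d); last first.
  right=> a /prodv_surj[z defa]; exists (len z); apply/seteqP; split=> n; last first.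
    by move=> /= ->; apply/lengthsP; exists z.
  move=> /lengthsP[w wa <-] /=; apply: contrapT => ne; apply: nd.
  have fT x : face eqv [set: I]%SET x.
    by apply: (face_supp eqv_refl) => e; rewrite inE.
  have zw : eqv z w by rewrite /eqv defa wa.
  wlog lt : z w defa wa ne zw / len z < len w.
    move=> wl; have [lt|ge] := ltnP (len z) (len w); first exact: wl lt.
    apply: (wl w z) => //; first by move=> h; apply: ne; rewrite h.
    by rewrite ltn_neqAle ge andbT; apply/eqP.
  exists (len w - len z); split; first by rewrite subn_gt0.
  by exists z, w; split=> //; rewrite subnKC // ltnW.
left; exists (M + 2 * M * E) => a /prodv_surj[z defa].
have [dT hdT] := min_diff_exists hd0.
have Lz : lengths H a (len z) by apply/lengthsP; exists z.
have ub l : `[< lengths H a l >] -> l <= wlen wt z.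
  move=> /asboolP/lengthsP[x xa <-]; rewrite -(@prodv_wt x z) ?/eqv ?xa ?defa //.
  exact: (len_le_wlen wt_pos).
have ex : exists l, `[< lengths H a l >] by exists (len z); apply/asboolP.
have [lo /asboolP Llo lomin] := ex_minnP ex.
have [hi /asboolP Lhi himax] := ex_maxnP ex ub.
have Lb l : lengths H a l -> lo <= l <= hi.
  by move=> /asboolP Ll; rewrite lomin // himax.
have toz x l : prodv x = a -> eqv x z by rewrite /eqv defa.
have [lox loa llo] := (lengthsP _ _).1 Llo.
have [hix hia lhi] := (lengthsP _ _).1 Lhi.
have weaken (d M' M'' : nat) L : M' <= M'' -> AAMP d M' L -> AAMP d M'' L.
  move=> MM [d_gt0 [D [D0 Dd Db [y [L1 [Ls [L2 [mx [h1 h2 h3 h4 h5]]]]]]]]].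
  split=> //; exists D; split=> //; exists y, L1, Ls, L2, mx; split=> //.
    by move=> x /h4 /=; lia.
  by move=> x /h5 /=; lia.
(* For bounded spread any positive difference is admissible and [dT] is taken; in the other case the
   difference is that of the face belonging to [z]. *)
have [bd|[A [d [hd dE hc]]]] := hM z.
  exists dT; first exact: min_diff_minimal_distance hdT.
  apply: weaken (leq_addr _ _) _; apply: (AAMP_of_bounded _ Llo Lb).
    by case: hdT => -[].
  by rewrite -llo -lhi; apply: bd; rewrite /eqv ?loa ?hia defa.
exists d; first exact: min_diff_minimal_distance hd.
apply: weaken (leq_addl _ _) _; apply: (AAMP_of_center _ dE Llo Lhi Lb).
  by case: hd => -[].
move=> l w /lengthsP[wx wa lw] h1 h2 h3; apply/lengthsP.
have [||||||z' z'z lz'] := hc lox hix wx l; rewrite /eqv ?loa ?hia ?wa ?llo ?lhi ?lw //.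
by exists z' => //; rewrite -defa.
Qed.

End FinitelyManyAtoms.

(** * Plus-minus weighted zero-sum sequences *)

Section PlusMinus.
Variable G : zmodType.
Implicit Types (A B S T : {mset G}) (g h : G).
Local Open Scope ring_scope.

Lemma count_mask_negb (T : Type) (p : pred T) (m : bitseq) (s : seq T) :
  size m = size s ->
  count p s = (count p (mask m s) + count p (mask (map negb m) s))%N.
Proof.
elim: s m => [|x s IH] [|b m] //= [/IH->].
by case: b => /=; lia.
Qed.

Lemma sum_signed_mask (m : bitseq) (s : seq G) : size m = size s ->
  \sum_(i < size s) s`_i *~ (if nth false m i then 1 else -1) =
  \sum_(x <- mask m s) x - \sum_(x <- mask (map negb m) s) x.
Proof.
elim: s m => [|x s IH] [|b m] //= => [_|[/IH sm]].
  by rewrite big_ord0 big_nil subrr.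
rewrite big_ord_recl /= sm; case: b => /=; rewrite big_cons ?mulr1z ?mulrN1z.
  by rewrite addrA.
by rewrite opprD addrCA.
Qed.

(** [A] and [B] collect the terms with sign 1 and -1; this form is independent of the enumeration of
    [S]. *)
Lemma pm_zero_sumP S : pm_zero_sum G S <->
  exists A B, S = (A `+` B)%mset /\ \sum_(x <- A) x = \sum_(x <- B) x.
Proof.
have sumE (s : seq G) : \sum_(x <- seq_mset s) x = \sum_(x <- s) x.
  exact: perm_big (perm_eq_seq_mset s).
split=> [[eps [epsP sum0]]|[A [B [defS AB]]]].
  pose m := mkseq (fun i => eps i == 1) (size S).
  have sm : size m = size S by rewrite size_mkseq.
  exists (seq_mset (mask m S)), (seq_mset (mask (map negb m) S)); split.
    apply/msetP => x.
    by rewrite msetE2 !mset_seqE -(count_mask_negb _ sm) count_mem_mset.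
  apply/eqP; rewrite !sumE -subr_eq0 -sum_signed_mask //; apply/eqP; rewrite -[RHS]sum0.
  apply: eq_bigr => i _; rewrite nth_mkseq //.
  by case: (epsP i) => ->.
have [|s' /subseqP[m sm def_s'] As'] := (@count_subseqP _ (A : seq G) (S : seq G)).1.
  by move=> x; rewrite !count_mem_mset defS msetE2 leq_addr.
exists (fun i => if nth false m i then 1 else -1); split.
  by move=> i; case: ifP => _; [left | right].
rewrite sum_signed_mask //; apply/eqP; rewrite subr_eq0; apply/eqP.
rewrite -def_s' -(perm_big _ As') AB; apply: perm_big; apply/allP => x _ /=.
have := count_mask_negb (pred1 x) sm; rewrite -def_s' -(permP As').
by rewrite !count_mem_mset defS msetE2 => /addnI <-.
Qed.

Lemma zero_sum_pm S : zero_sum G S -> pm_zero_sum G S.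
Proof.
move=> S0; apply/pm_zero_sumP; exists S, mset0; split; first by rewrite msetD0.
by rewrite [RHS]big_mset0.
Qed.

Lemma pm_zero_sum_submonoid : submonoid (pm_zero_sum G).
Proof.
split; first by apply: zero_sum_pm; rewrite /zero_sum /= big_mset0.
move=> _ _ /pm_zero_sumP[A [B [-> AB]]] /pm_zero_sumP[A' [B' [-> AB']]].
apply/pm_zero_sumP; exists (A `+` A')%mset, (B `+` B')%mset; split.
  by apply/msetP => x; rewrite !msetE2; lia.
by rewrite !big_msetDE AB AB'.
Qed.

Lemma pm_zero_sum_size1 S : pm_zero_sum G S -> size S = 1%N -> 0 \in S.
Proof.
move=> [eps [epsP +]] S1; rewrite S1 big_ord1 /= => h.
have h0 : (S : seq G)`_0 = 0.
  move: h; case: (epsP 0%N) => ->; rewrite ?mulr1z ?mulrN1z // => /eqP.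
  by rewrite oppr_eq0 => /eqP.
by have := @mem_nth _ 0 S 0; rewrite S1 h0; apply.
Qed.

(** A weighted zero-sum sequence of size 1 is the sequence 0, so both factors would need at least
    two terms. *)
Lemma pm_zero_sum_atom_small S : pm_zero_sum G S -> S <> mset0 ->
  (size S <= 3)%N -> 0 \notin S -> atom (pm_zero_sum G) S.
Proof.
move=> pS S0 S3 z; split=> // b c pb pc defS.
have nz (d : {mset G}) : pm_zero_sum G d -> (forall x, x \in d -> x \in S) ->
    size d <> 1%N.
  by move=> pd dS /(pm_zero_sum_size1 pd)/dS; rewrite (negPf z).
have := nz b pb; have := nz c pc.
have bS x : x \in b -> x \in S by rewrite defS in_msetD => ->.
have cS x : x \in c -> x \in S by rewrite defS in_msetD orbC => ->.
move=> /(_ cS) c1 /(_ bS) b1; have := S3; rewrite defS size_msetD => bc.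
have [sb|sc] : size b = 0%N \/ size c = 0%N by lia.
  by left; apply/eqP; rewrite -size_mset_eq0 sb.
by right; apply/eqP; rewrite -size_mset_eq0 sc.
Qed.

Lemma pm_zero_sum_double g : pm_zero_sum G ([mset g] `+` [mset g])%mset.
Proof. by apply/pm_zero_sumP; exists [mset g]%mset, [mset g]%mset. Qed.

Lemma lengths_three (K : choiceType) (H : set {mset K}) a b c :
  atom H a -> atom H b -> atom H c -> lengths H (a `+` b `+` c)%mset 3.
Proof.
move=> Ha Hb Hc; exists ([mset a] `+` [mset b] `+` [mset c])%mset; last first.
  by rewrite size_msetD size_msetD !size_mset1.
split=> [u|].
  by move=> /msetDP[/msetDP[]|] /mset1P->.
by apply/msetP => x; rewrite big_msetD_app big_msetDE big_msetDE !big_mset1E !msetE2.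
Qed.

(** With [U] the atom made of [g], [h], [g + h], its square is also the product of the squares of
    these three elements. *)
Lemma lengths_two_three g h : g != 0 -> h != 0 -> g + h != 0 ->
  exists S, [/\ pm_zero_sum G S, lengths (pm_zero_sum G) S 2 &
                 lengths (pm_zero_sum G) S 3].
Proof.
move=> g0 h0 gh0.
have at2 x : x != 0 -> atom (pm_zero_sum G) ([mset x] `+` [mset x])%mset.
  move=> x0; apply: pm_zero_sum_atom_small.
  - exact: pm_zero_sum_double.
  - by move=> /msetP/(_ x); rewrite msetE2 mset0E !msetnxx.
  - by rewrite size_msetD !size_mset1.
  - by rewrite in_msetD !in_mset1 orbb eq_sym.
pose U := ([mset g] `+` [mset h] `+` [mset g + h])%mset.
have atU : atom (pm_zero_sum G) U.
  apply: pm_zero_sum_atom_small.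
  - apply/pm_zero_sumP; exists ([mset g] `+` [mset h])%mset, [mset g + h]%mset.
    by split=> //; rewrite big_msetDE !big_mset1E.
  - by move=> /msetP/(_ g); rewrite !msetE2 mset0E msetnxx.
  - by rewrite !size_msetD !size_mset1.
  - by rewrite !in_msetD !in_mset1 ![0 == _]eq_sym (negPf g0) (negPf h0) (negPf gh0).
exists (U `+` U)%mset; split.
- by case: atU => pU _ _; apply: pm_zero_sum_submonoid.2.
- exists ([mset U] `+` [mset U])%mset; last by rewrite size_msetD !size_mset1.
  split=> [u|]; first by rewrite in_msetD !in_mset1 orbb => /eqP->.
  by apply/msetP => x; rewrite big_msetD_app big_msetDE !big_mset1E msetE2.
have -> : (U `+` U = ([mset g] `+` [mset g]) `+` ([mset h] `+` [mset h]) `+`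
    ([mset g + h] `+` [mset g + h]))%mset.
  by apply/msetP => x; rewrite /U !msetE2; lia.
by apply: lengths_three; apply: at2.
Qed.

(** * Finite groups: finitely many atoms *)

Section FiniteGroup.
Hypothesis G_fin : finite_set [set: G].

Lemma finite_torsion g : exists2 m, (0 < m)%N & g *+ m = 0.
Proof.
have : ~ injective (fun n => g *+ n).
  move=> inj; apply: infinite_nat.
  have e := @inj_card_eq _ _ [set: nat] (fun n => g *+ n) (in2W inj).
  by rewrite -(eq_finite_set e); apply: sub_finite_set G_fin.
move=> ninj; apply: contrapT => nm; apply: ninj => i j.
wlog ij : i j / (i <= j)%N => [wl|].
  by case/orP: (leq_total i j) => [/wl|/wl h /esym/h].
move=> /= gij; apply: contrapT => ne; apply: nm; exists (j - i)%N; first by lia.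
by apply: (addrI (g *+ i)); rewrite -mulrnDr subnKC // addr0 gij.
Qed.

(** If [g] occurs with both signs, one copy from each side splits off as the square of [g]. If it
    occurs with one sign only, [m] copies split off, where [m] annihilates [g]. *)
Lemma pm_zero_sum_atom_bound g : exists m : nat, forall S,
  atom (pm_zero_sum G) S -> (S g <= m)%N.
Proof.
(* The extra 2 guarantees that [g] survives in the complement in both cases, so that neither factor
   is empty. *)
have [m m0 gm] := finite_torsion g; exists (m + 2)%N => S [pS S0 Sat].
have /pm_zero_sumP[A [B [defS AB]]] := pS.
rewrite leqNgt; apply/negP => big.
have split_off (C : {mset G}) : pm_zero_sum G C -> (C `<=` S)%mset ->
    (0 < C g < S g)%N -> ~ pm_zero_sum G (S `\` C)%mset.
  move=> pC CS Cg pSC; have := Sat C (S `\` C)%mset pC pSC.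
  rewrite msetBDKC // => /(_ erefl)[C0|SC0].
    by move: Cg; rewrite C0 mset0E.
  by have /msetP/(_ g) := SC0; rewrite msetE2 mset0E; lia.
wlog ABg : A B defS AB / (B g <= A g)%N.
  move=> wl; case/orP: (leq_total (B g) (A g)) => [|le]; first exact: wl AB.
  by apply: (wl B A) => //; rewrite msetDC.
have [Bg|Bg] := posnP (B g).
  have Ag : (m + 2 < A g)%N by move: big; rewrite defS msetE2; lia.
  have mA : (msetn m g `<=` A)%mset.
    by apply/msubsetP => x; rewrite msetnE; case: eqP => [->|]//; lia.
  apply: (split_off (msetn m g)).
  - apply: zero_sum_pm; rewrite /zero_sum /= enum_msetn big_nseq.
    by rewrite iter_addr_0.
  - by apply/msubsetP => x; rewrite defS msetE2 (leq_trans (msubsetP mA x)) // leq_addr.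
  - by rewrite msetnxx m0; lia.
  apply/pm_zero_sumP; exists (A `\` msetn m g)%mset, B; split.
    by apply/msetP => x; have := msubsetP mA x; rewrite defS !msetE2; lia.
  apply: (addrI (\sum_(x <- msetn m g) x)); rewrite -big_msetDE msetBDKC //.
  suff -> : \sum_(x <- msetn m g) x = 0 by rewrite add0r.
  by rewrite enum_msetn big_nseq iter_addr_0.
have gA : ([mset g] `<=` A)%mset by rewrite msub1set in_mset; lia.
have gB : ([mset g] `<=` B)%mset by rewrite msub1set in_mset; lia.
apply: (split_off ([mset g] `+` [mset g])%mset); first exact: pm_zero_sum_double.
- apply/msubsetP => x; have := msubsetP gA x; have := msubsetP gB x.
  by rewrite defS !msetE2; lia.
- by rewrite msetE2 msetnxx; lia.
apply/pm_zero_sumP; exists (A `\` [mset g])%mset, (B `\` [mset g])%mset; split.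
  apply/msetP => x; have := msubsetP gA x; have := msubsetP gB x.
  by rewrite defS !msetE2; lia.
by apply: (addrI (\sum_(x <- [mset g]%mset) x)); rewrite -!big_msetDE !msetBDKC.
Qed.

Lemma pm_zero_sum_finite_atoms : finite_set (atom (pm_zero_sum G)).
Proof.
have /choice[b hb] := pm_zero_sum_atom_bound.
have [s hs] := (finite_seqP _).1 G_fin.
have sT x : x \in s by have : [set: G] x by []; rewrite hs.
pose N := (\sum_(x <- s) b x)%N.
have bN x : (b x <= N)%N by rewrite /N (big_rem x (sT x)) leq_addr.
pose f (S : {mset G}) : {ffun seq_sub s -> 'I_N.+1} := [ffun e => inord (S (val e))].
have finj : {in (atom (pm_zero_sum G) : set {mset G}) &, injective f}.
  move=> S T /set_mem Sat /set_mem Tat /ffunP fST; apply/msetP => x.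
  have := congr1 val (fST (SeqSub (sT x))); rewrite !ffunE /= !inordK //.
    by rewrite ltnS (leq_trans (hb _ _ Tat)).
  by rewrite ltnS (leq_trans (hb _ _ Sat)).
by rewrite -(eq_finite_set (inj_card_eq finj)); apply: finite_finset.
Qed.

Theorem pm_zero_sum_structure : exists M : nat, forall S, pm_zero_sum G S ->
     (exists2 d : nat, minimal_distances (pm_zero_sum G) d &
        AAMP d M (int_set (lengths (pm_zero_sum G) S)))
     \/ ([set: G] #<= `I_2 /\
         exists n : nat, lengths (pm_zero_sum G) S = [set n]).
Proof.
have [[M hM]|single] :=
  structure_of_lengths pm_zero_sum_submonoid pm_zero_sum_finite_atoms.
  by exists M => S /hM; left.
exists 0%N => S pS; right; split; last exact: single.
(* If all sets of lengths are singletons, no two nonzero elements may have nonzero sum. So every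
   nonzero element equals the negative of a fixed one, and [G] has at most two elements. *)
have add0 g h : g != 0 -> h != 0 -> g + h = 0.
  move=> g0 h0; apply/eqP/negPn/negP => gh0.
  have [T [pT L2 L3]] := lengths_two_three g0 h0 gh0.
  have [n Ln] := single T pT; rewrite Ln in L2 L3.
  by have := etrans (L2 : 2%N = n) (esym (L3 : 3%N = n)).
have [c hc] : exists c : G, forall x, x != 0 -> x = c.
  have [[g g0]|ng] := pselect (exists g : G, g != 0); last first.
    by exists 0 => x x0; case: ng; exists x.
  by exists (- g) => x x0; apply/eqP; rewrite -addr_eq0 add0.
apply: card_le_trans (card_image_le (fun i => if i is 0 then 0 else c) `I_2).
apply: subset_card_le => x _; have [->|/hc->] := eqVneq x 0; first by exists 0%N.
by exists 1%N.
Qed.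

End FiniteGroup.
End PlusMinus.

(** * Generic elements of infinite groups *)

Section GenericElements.
Variable G : zmodType.
Local Open Scope ring_scope.
Implicit Types (x y s : G) (X F : set G) (p : nat) (c : int).

(* [X] behaves like an infinite subset in general position over Z/p, where
   p = 0 stands for Z. *)
Definition almost_free p X : Prop :=
  [/\ p <> 1%N, infinite_set X, (forall x, X x -> x *+ p = 0) &
      forall c s, ~~ (p %| c)%Z -> finite_set (X `&` [set x | x *~ c = s])].

(** Division by [n] proceeds one prime at a time, and a nonempty fibre of multiplication by a prime
    is a translate of its torsion. *)
Lemma finite_division :
  (forall q, prime q -> finite_set [set x : G | x *+ q = 0]) ->
  forall n s, (0 < n)%N -> finite_set [set x | x *+ n = s].
Proof.
move=> fin; have finq q s : prime q -> finite_set [set x | x *+ q = s].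
  move=> pq; have [[y ys]|ny] := pselect (exists y, y *+ q = s).
    apply: sub_finite_set (finite_image (fun x => x + y) (fin q pq)) => x /= xs.
    by exists (x - y); rewrite ?subrK //= mulrnBl xs ys subrr.
  by apply: sub_finite_set (@finite_set0 G) => x xs; case: ny; exists x.
move=> n; have [m] := ubnP n; elim: m n => // m IH n; rewrite ltnS => nm s n0.
have [n1|n1] := leqP n 1.
  apply: sub_finite_set (finite_set1 s) => x /=.
  by have -> : n = 1%N by [lia]; rewrite mulr1n.
have pq := pdiv_prime n1; set q := pdiv n in pq.
have def_n : (n = n %/ q * q)%N by rewrite divnK // pdiv_dvd.
have q1 := prime_gt1 pq.
have k0 : (0 < n %/ q)%N by rewrite divn_gt0 ?prime_gt0 // dvdn_leq // pdiv_dvd.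
apply: (@sub_finite_set _ _
    (\bigcup_(y in [set y | y *+ q = s]) [set x | x *+ (n %/ q) = y])).
  by move=> x /=; rewrite {1}def_n mulrnA => xs; exists (x *+ (n %/ q)).
apply: bigcup_finite; first exact: finq.
by move=> y _; apply: IH => //; apply: leq_trans nm; rewrite ltn_Pdiv.
Qed.

(** If some prime [q] has infinite torsion, Bezout makes multiplication by any [c] prime to [q]
    injective there. Otherwise all of [G] serves with [p = 0], because all fibres of nonzero
    multiplications are finite. *)
Lemma almost_free_exists : infinite_set [set: G] -> exists p X, almost_free p X.
Proof.
move=> Ginf; have [[q [pq qinf]]|nq] :=
    pselect (exists q, prime q /\ infinite_set [set x : G | x *+ q = 0]).
  exists q, [set x : G | x *+ q = 0]; split=> // [q1|c s qc].
    by rewrite q1 in pq.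
  have [u [v uv]] := Bezoutz q c.
  have g1 : gcdz q c = 1.
    by apply/eqP; rewrite -/(coprimez q c) coprimezE /= prime_coprime.
  apply: sub_finite_set (finite_set1 (s *~ v)) => x [/= xq <-].
  have : x *~ (q%:Z * u + c * v) = x by rewrite mulrC [c * v]mulrC uv g1.
  by rewrite mulrzDr !mulrzA -pmulrn xq mul0rz add0r => ->.
exists 0%N, [set: G]; split=> // c s c0.
have fin := finite_division (fun q pq => contrapT (fun h => nq (ex_intro _ q (conj pq h)))).
have {c0} c0 : (0 < absz c)%N by rewrite absz_gt0; rewrite dvd0z in c0.
rewrite setTI; apply: sub_finite_set (fin (absz c) (s *~ sgz c) c0) => x /= <-.
by rewrite -mulrzA pmulrn abszEsg mulrC.
Qed.

Lemma sum_almost_free (I : Type) (r : seq I) (P : pred I) p X (x : I -> G)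
    (c : I -> int) : almost_free p X -> (forall i, X (x i)) ->
  (forall i, P i -> (p %| c i)%Z) -> \sum_(i <- r | P i) x i *~ c i = 0.
Proof.
move=> [_ _ pX _] Xx pc; apply: big1 => i /pc/dvdzP[k ->].
by rewrite mulrC mulrzA -pmulrn pX ?mul0rz.
Qed.

Lemma finite_int_ball K : finite_set [set c : int | (absz c <= K)%N].
Proof.
by apply: sub_finite_set (finite_int_range (- K%:Z) K) => c /=; lia.
Qed.

(** Only finitely many pairs of a coefficient and a value are forbidden, and each excludes finitely
    many elements of the infinite set [X]. *)
Lemma generic_element p X K F : almost_free p X -> finite_set F ->
  exists2 x, X x & forall c, (absz c <= K)%N -> F (x *~ c) -> (p %| c)%Z.
Proof.
move=> [p1 Xinf pX fin] Ffin; apply: contrapT => nx; apply: Xinf.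
pose bad (cs : int * G) := X `&` [set x | x *~ cs.1 = cs.2 /\ ~~ (p %| cs.1)%Z].
apply: (@sub_finite_set _ _ (\bigcup_(cs in
    [set c : int | (absz c <= K)%N] `*` F) bad cs)).
  move=> x Xx; apply: contrapT => nb; apply: nx; exists x => // c cK Fc.
  by apply/negPn/negP => pc; apply: nb; exists (c, x *~ c).
apply: bigcup_finite; first by apply: finite_setX => //; exact: finite_int_ball.
move=> [c s] _; rewrite /bad /=; have [pc|pc] := boolP (p %| c)%Z.
  by apply: sub_finite_set (@finite_set0 G) => x [_ [_ /negP]]; case.
by apply: sub_finite_set (fin c s pc) => x [Xx [xs _]].
Qed.

Lemma generic_family_seq (U : eqType) p X K (us : seq U) F :
  almost_free p X -> finite_set F -> uniq us ->
  exists x : U -> G, (forall u, X (x u)) /\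
    forall c : U -> int, (forall u, absz (c u) <= K)%N ->
      F (\sum_(u <- us) x u *~ c u) -> forall u, u \in us -> (p %| c u)%Z.
Proof.
move=> Xp; have [_ Xinf pX _] := Xp; elim: us F => [|u us IH] F Ffin.
  by move=> _; have [x Xx] := infinite_setN0 Xinf; exists (fun=> x).
move=> /= /andP[uus uu]; have [x Xx xP] := generic_element K Xp Ffin.
(* The later elements are generic with respect to [F] shifted by all multiples of [x]. Hence their
   coefficients are divisible by [p], their sum vanishes, and the genericity of [x] applies to what
   is left. *)
pose F' := (fun fc : G * int => fc.1 - x *~ fc.2) @`
  (F `*` [set c : int | (absz c <= K)%N]).
have [|y [Xy yP]] := IH F' _ uu.
  by apply: finite_image; apply: finite_setX => //; exact: finite_int_ball.
exists (fun v => if v == u then x else y v); split=> [v|c cK].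
  by case: eqP.
rewrite big_cons eqxx big_seq (eq_bigr (fun v => y v *~ c v)); last first.
  by move=> v vus; case: eqP => // vu; rewrite -vu vus in uus.
rewrite -big_seq => Fc.
have pcs v : v \in us -> (p %| c v)%Z.
  apply: yP => //; exists (x *~ c u + \sum_(j <- us) y j *~ c j, c u) => /=.
    by split=> //=; apply: cK.
  by rewrite addrC addKr.
have pcu : (p %| c u)%Z.
  apply: xP => //; move: Fc; rewrite big_seq.
  by rewrite (sum_almost_free _ Xp Xy) ?addr0.
by move=> v; rewrite inE => /predU1P[->|/pcs].
Qed.

Lemma generic_family (U : finType) p X K F :
  almost_free p X -> finite_set F ->
  exists x : U -> G, (forall u, X (x u)) /\
    forall c : U -> int, (forall u, absz (c u) <= K)%N ->
      F (\sum_u x u *~ c u) -> forall u, (p %| c u)%Z.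
Proof.
move=> Xp Ffin; have [x [Xx xP]] := generic_family_seq K Xp Ffin (enum_uniq U).
exists x; split=> // c cK Fc u; apply: (xP c cK); rewrite ?mem_enum //.
by rewrite big_enum.
Qed.

End GenericElements.

(* A function on the choice functions is separable modulo p if it is a sum of
   functions of the single coordinates; [defect] compares it with the only
   possible sum, which is determined by the points that differ from [base] in at
   most one coordinate. *)
Section Separable.
Variables (J : finType) (l : J -> nat).
Local Open Scope ring_scope.

(** Coordinate [i] takes [l i + 1] values, so [l i] is one less than the factorization length that
    [i] will provide. *)
Definition choice_point := {dffun forall i : J, 'I_(l i).+1}.
Implicit Types (v w u : choice_point) (p : nat) (e : choice_point -> int).

Definition base : choice_point := [ffun i => ord0].
Definition upd v i (r : 'I_(l i).+1) : choice_point := [ffun j => dfwith v r j].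

Lemma upd_eq v i (r : 'I_(l i).+1) : upd v r i = r.
Proof. by rewrite ffunE dfwith_in. Qed.

Lemma upd_neq v i (r : 'I_(l i).+1) j : j != i -> upd v r j = v j.
Proof. by move=> ji; rewrite ffunE dfwith_out // eq_sym. Qed.

Lemma upd_id v i : upd v (v i) = v.
Proof.
apply/ffunP => j; have [->|ji] := eqVneq j i; first exact: upd_eq.
exact: upd_neq.
Qed.

Definition defect e u : int :=
  e u - \sum_i e (upd base (u i)) + (#|J|%:Z - 1) * e base.

Definition separable p e := forall u, (p %| defect e u)%Z.

Lemma defect_linear (I : Type) (r : seq I) (c : I -> int) (E : I -> choice_point -> int) u :
  defect (fun v => \sum_(k <- r) c k * E k v) u = \sum_(k <- r) c k * defect (E k) u.
Proof.
rewrite /defect exchange_big mulr_sumr /= -sumrN -!big_split /=.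
by apply: eq_bigr => k _; rewrite -mulr_sumr; ring.
Qed.

Lemma defect_bound e u : (forall v, absz (e v) <= 1)%N ->
  (absz (defect e u) <= #|J|.*2.+2)%N.
Proof.
move=> e1; have s1 : (absz (\sum_i e (upd base (u i)))%R <= #|J|)%N.
  rewrite -sum1_card; elim/big_ind2: _ => [//|x m y n h1 h2|i _ //].
  by apply: leq_trans (leq_add h1 h2); rewrite -lez_nat; lia.
move: s1 (e1 base) (e1 u); rewrite /defect; move: (\sum_i _) => S.
by move: (e base) (e u) #|J| => a b n; nia.
Qed.

Lemma defect_slice i (r : 'I_(l i).+1) u :
  defect (fun v => ((v i == r) : nat)%:Z) u = 0.
Proof.
rewrite /defect (bigD1 i) //= upd_eq (eq_bigr (fun=> ((base i == r) : nat)%:Z)).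
  have J0 : (0 < #|J|)%N by apply/card_gt0P; exists i.
  rewrite sumr_const cardC1 -mulr_natl natz -{2}(prednK J0).
  by move: (nat_of_bool _) (nat_of_bool _) => a b; lia.
by move=> j ji; rewrite upd_neq // eq_sym.
Qed.

Lemma separable_upd p e v i (r : 'I_(l i).+1) : separable p e ->
  (p %| e (upd v r) - e v - (e (upd base r) - e (upd base (v i))))%Z.
Proof.
move=> se; suff -> : e (upd v r) - e v - (e (upd base r) - e (upd base (v i))) =
    defect e (upd v r) - defect e v by rewrite rpredB.
rewrite /defect (bigD1 i) //= [X in _ = _ - (_ - X + _)](bigD1 i) //= upd_eq.
rewrite (eq_bigr (fun j => e (upd base (v j)))); first by ring.
by move=> j ji; rewrite upd_neq.
Qed.

Lemma separable_square p e v w i (r : 'I_(l i).+1) : separable p e -> v i = w i ->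
  (p %| e (upd v r) - e v - (e (upd w r) - e w))%Z.
Proof.
move=> se vw; have := rpredB (separable_upd v r se) (separable_upd w r se).
rewrite vw; move: (e (upd base r) - e (upd base (w i))) => D h.
have -> : e (upd v r) - e v - (e (upd w r) - e w) =
    e (upd v r) - e v - D - (e (upd w r) - e w - D) by ring.
exact: h.
Qed.

(** Models the index set of a plus-minus weighted zero-sum subsequence, with [e] the function of its
    signs. *)
Definition sepset p (T : pred choice_point) :=
  exists2 e, separable p e & forall v, T v = ~~ (p %| e v)%Z.

Definition depends_on i (T : pred choice_point) := forall v w, v i = w i -> T v = T w.

(** Moving [v] into the slice where [e] vanishes modulo [p] changes [e] by an amount that depends
    only on [v i]; so [e v] itself is determined modulo [p] by [v i]. *)
Lemma sepset_avoiding_slice p T i (r : 'I_(l i).+1) :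
  sepset p T -> (forall v, v i = r -> ~~ T v) -> depends_on i T.
Proof.
move=> [e se defT] Tr v w vw; rewrite !defT; congr (~~ _).
have val u : (p %| e u)%Z = (p %| e (upd base r) - e (upd base (u i)))%Z.
  have /Tr : upd u r i = r by rewrite upd_eq.
  rewrite defT negbK => eu; have := separable_upd u r se.
  move: (e (upd base r) - _) => D h.
  have -> : e u = e (upd u r) - (e (upd u r) - e u - D) - D by ring.
  by rewrite rpredBl // rpredB.
by rewrite !val vw.
Qed.

Lemma sepset_disjoint p i T T' v : depends_on i T -> T v -> sepset p T' ->
  (forall w, T w -> ~~ T' w) -> depends_on i T'.
Proof.
move=> dT Tv sT' TT'; apply: (@sepset_avoiding_slice p T' i (v i) sT') => w wv.
by apply: TT'; rewrite (dT w v).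
Qed.

(* Along a pair of slices on which the first function changes its value, either
   the second one does not change, and then it vanishes there, or the first two
   exhaust both slices and the third one vanishes there. *)
Lemma three_sepsets p T1 T2 T3 v1 v2 v3 : sepset p T1 -> sepset p T2 -> sepset p T3 ->
  T1 v1 -> T2 v2 -> T3 v3 ->
  (forall v, ~~ (T1 v && T2 v) /\ ~~ (T1 v && T3 v) /\ ~~ (T2 v && T3 v)) ->
  exists i, depends_on i T2 \/ depends_on i T3.
Proof.
move=> [e1 s1 d1] sT2 sT3 Tv1 Tv2 Tv3 dis; have [e2 s2 d2] := sT2.
have [[i [r [r' nD]]]|nD] := pselect (exists i (r r' : 'I_(l i).+1),
    ~~ (p %| e1 (upd base r) - e1 (upd base r'))%Z); last first.
  (* If no coordinate changes [e1] modulo [p], then [e1] is constant modulo [p], which contradicts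
     its values at [v1] and [v2]. *)
  have const u : (p %| e1 u - e1 base)%Z.
    have -> : e1 u - e1 base =
        defect e1 u + \sum_i (e1 (upd base (u i)) - e1 (upd base (base i))).
      rewrite sumrB (eq_bigr (fun=> e1 base) (F1 := fun i => e1 (upd base (base i)))).
        by rewrite sumr_const -mulr_natl natz /defect; ring.
      by move=> i _; rewrite upd_id.
    rewrite rpredD // rpred_sum // => i _; apply/negPn/negP => ni.
    by apply: nD; exists i, (u i), (base i).
  have [nT12 _] := dis v2; move: nT12; rewrite Tv2 andbT d1 negbK => pv2.
  move: Tv1; rewrite d1 => /negP[].
  have -> : e1 v1 = (e1 v1 - e1 base) - (e1 v2 - e1 base) + e1 v2 by ring.
  by rewrite rpredD // rpredB.
exists i; pose D (e : choice_point -> int) := e (upd base r) - e (upd base r').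
have step e u : separable p e -> (p %| e (upd u r) - e (upd u r') - D e)%Z.
  move=> se; have := separable_upd u r se; have := separable_upd u r' se.
  move=> h h'; have := rpredB h' h; rewrite /D.
  by congr (_ %| _)%Z; ring.
have one e u : separable p e -> ~~ (p %| D e)%Z ->
    ~~ (p %| e (upd u r))%Z || ~~ (p %| e (upd u r'))%Z.
  move=> se nDe; rewrite -negb_and; apply: contra nDe => /andP[h h'].
  have -> : D e = e (upd u r) - e (upd u r') - (e (upd u r) - e (upd u r') - D e) by ring.
  by rewrite rpredB ?step // rpredB.
have [pD2|nD2] := boolP (p %| D e2)%Z.
  left; apply: (@sepset_avoiding_slice p T2 i r sT2) => v vr.
  have eqv : upd v r = v by rewrite -vr upd_id.
  have := one e1 v s1 nD; rewrite -!d1 eqv => /orP[Tv|Tv'].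
    by have [+ _] := dis v; rewrite Tv.
  have [+ _] := dis (upd v r'); rewrite Tv' /= !d2 !negbK => h.
  have := step e2 v s2; rewrite eqv => h'.
  have -> : e2 v = (e2 v - e2 (upd v r') - D e2) + D e2 + e2 (upd v r') by ring.
  by apply: rpredD h; apply: rpredD pD2.
right; apply: (@sepset_avoiding_slice p T3 i r sT3) => v vr.
have eqv : upd v r = v by rewrite -vr upd_id.
have := one e1 v s1 nD; have := one e2 v s2 nD2; rewrite -!d1 -!d2 eqv.
have := dis v; have := dis (upd v r').
case: (T1 v) (T2 v) (T3 v) => [] [] [] [h1 [h2 h3]] [h4 [h5 h6]] //.
by case: (T1 _) (T2 _) h1 => [] [].
Qed.

(** Let [v] and [v'] differ in coordinate [d]. The square spanned at [v] by two further coordinates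
    keeps [v d], so it avoids [v'] and meets [v] once; its alternating sum is -1, although
    separability makes it divisible by [p]. Hence three coordinates are required. *)
Lemma separable_delta_neq p v v' : (2 < #|J|)%N -> (forall i, 0 < l i)%N -> p <> 1%N ->
  separable p (fun u => ((u == v) : nat)%:Z - ((u == v') : nat)%:Z) -> v = v'.
Proof.
move=> J3 l0 p1 se; apply/eqP/negPn/negP => vv'.
have [d vd] : exists d, v d != v' d.
  apply/existsP; rewrite -negb_forall; apply: contra vv' => /forallP h.
  by apply/eqP/ffunP => i; apply/eqP.
have [i id] : exists i, i != d.
  have : (0 < #|predC1 d|)%N by rewrite cardC1; lia.
  by move=> /card_gt0P[i ?]; exists i.
have [j jd ji] : exists2 j, j != d & j != i.
  have : (0 < #|[predD1 predC1 d & i]|)%N.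
    have := cardC1 d; rewrite (cardD1 i) inE /= id add1n => h.
    by rewrite -ltnS h; case: #|J| J3 => [|[|[|]]].
  by move=> /card_gt0P[j]; rewrite !inE => /andP[? ?]; exists j.
have other k (x : 'I_(l k).+1) : exists r, r != x.
  have : (0 < #|predC1 x|)%N by rewrite cardC1 card_ord l0.
  by move=> /card_gt0P[r ?]; exists r.
have [r rv] := other i (v i); have [r' rv'] := other j (v j).
pose w := upd v r'.
have nv' u : u d = v d -> (u == v') = false.
  by move=> ud; apply/negP => /eqP uv; move: vd; rewrite -ud uv eqxx.
have nv u k : u k != v k -> (u == v) = false.
  by move=> uk; apply/negP => /eqP uv; move: uk; rewrite uv eqxx.
have vw : v i = w i by rewrite upd_neq // eq_sym.
have := separable_square r se vw.
rewrite (nv _ i) ?upd_eq // (nv w j) ?upd_eq // (nv (upd w r) j); last first.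
  by rewrite upd_neq // upd_eq.
have di : d != i by rewrite eq_sym.
have dj : d != j by rewrite eq_sym.
rewrite (nv' v) // (nv' (upd v r)) ?upd_neq // (nv' w) ?upd_neq //.
rewrite (nv' (upd w r)) ?upd_neq // eqxx.
by rewrite /= dvdzE /= dvdn1 => /eqP.
Qed.

End Separable.

(** * Sequences with prescribed factorizations *)

Section DesignExists.
Variables (G : zmodType) (p : nat) (X : set G) (J : finType) (l : J -> nat).
Hypotheses (Xp : almost_free p X) (J3 : 2 < #|J|) (l0 : forall i, 0 < l i).
Local Open Scope ring_scope.
Let V := choice_point l.

Lemma eq_defect (e e' : V -> int) u : e =1 e' -> defect e u = defect e' u.
Proof.
by move=> ee'; rewrite /defect !ee'; congr (_ - _ + _); apply: eq_bigr.
Qed.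

(** [g v] combines generic elements [x u] with coefficients the defects of the indicator of [v]. By
    linearity a signed sum of the [g v] has the defects of [e] as coefficients, so vanishing forces
    separability, and slices, having zero defect, sum to zero. *)
Lemma design_exists : exists g : V -> G, [/\ injective g,
  forall e, (forall v, absz (e v) <= 1)%N -> \sum_v g v *~ e v = 0 -> separable p e &
  forall i (r : 'I_(l i).+1), \sum_(v : V | v i == r) g v = 0].
Proof.
have [x [Xx xP]] := generic_family V #|J|.*2.+2 Xp (finite_set1 (0 : G)).
pose delta (v u : V) : int := ((u == v) : nat)%:Z.
pose g v := \sum_u x u *~ defect (delta v) u.
have sum_g e : \sum_v g v *~ e v = \sum_u x u *~ defect e u.
  rewrite /g; under eq_bigr do rewrite mulrz_suml.
  rewrite exchange_big; apply: eq_bigr => u _ /=.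
  under eq_bigr do rewrite -mulrzA mulrC.
  rewrite -mulrz_sumr -defect_linear; congr (_ *~ _); apply: eq_defect => w.
  rewrite (bigD1 w) //= /delta eqxx mulr1 big1 ?addr0 // => v vw.
  by rewrite eq_sym (negPf vw) mulr0.
have sepP e : (forall v, absz (e v) <= 1)%N -> \sum_v g v *~ e v = 0 -> separable p e.
  move=> e1; rewrite sum_g => h u; apply: (xP (defect e)) => // w.
  exact: defect_bound.
exists g; split=> // [v v' gvv'|i r].
  apply: (@separable_delta_neq J l p) => //; first by case: Xp.
  apply: sepP => [u|]; first by case: eqP; case: eqP.
  under eq_bigr do rewrite mulrzBr; rewrite sumrB.
  rewrite (bigD1 v) //= eqxx mulr1z big1 ?addr0; last first.
    by move=> u /negPf->; rewrite mulr0z.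
  rewrite (bigD1 v') //= eqxx mulr1z big1 ?addr0; last first.
    by move=> u /negPf->; rewrite mulr0z.
  by rewrite gvv' subrr.
rewrite big_mkcond /=.
transitivity (\sum_v g v *~ (((v i == r) : nat)%:Z)).
  by apply: eq_bigr => v _; case: eqP; rewrite ?mulr1z ?mulr0z.
by rewrite sum_g big1 // => u _; rewrite defect_slice mulr0z.
Qed.

End DesignExists.

Section Design.
Variables (G : zmodType) (p : nat) (J : finType) (l : J -> nat).
Hypotheses (p1 : p <> 1) (J3 : 2 < #|J|) (l0 : forall i, 0 < l i).
Notation V := (choice_point l).
Variable g : V -> G.
Hypotheses (g_inj : injective g)
  (g_sep : forall e, (forall v, absz (e v) <= 1) ->
     (\sum_v g v *~ e v = 0)%R -> separable p e)
  (g_slice : forall i (r : 'I_(l i).+1), (\sum_(v : V | v i == r) g v = 0)%R).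
Implicit Types (v w : V) (A B T u : {mset G}) (i : J).

Definition gset (P : pred V) : {mset G} := seq_mset [seq g v | v <- enum P].

Lemma gsetE P v : gset P (g v) = P v.
Proof.
by rewrite mset_seqE (count_map g) (eq_count (a2 := pred1 v)) ?count_uniq_mem
  ?enum_uniq ?mem_enum // => w /=; rewrite (inj_eq g_inj).
Qed.

Definition full := gset predT.

Lemma fullE v : full (g v) = 1.
Proof. exact: gsetE. Qed.

Lemma gset_sub P : (gset P `<=` full)%mset.
Proof.
apply/msubsetP => x; rewrite !mset_seqE; have [xP|/count_memPn->//] := boolP (x \in map g (enum P)).
by have /mapP[v _ ->] := xP; rewrite -!mset_seqE gsetE fullE; case: (P v).
Qed.

Lemma full_supp T x : (T `<=` full)%mset -> x \in T -> exists v, g v = x.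
Proof.
move=> /msubset_subset TS /TS; rewrite (perm_mem (perm_eq_seq_mset _)).
by move=> /mapP[v _ ->]; exists v.
Qed.

Lemma full_ext A B : (A `<=` full)%mset -> (B `<=` full)%mset ->
  (forall v, A (g v) = B (g v)) -> A = B.
Proof.
move=> AS BS AB; apply/msetP => x.
have [/(full_supp AS)[v <-] //|/mset_eq0P Ax] := boolP (x \in A).
have [/(full_supp BS)[v <-] //|/mset_eq0P Bx] := boolP (x \in B).
by rewrite Ax Bx.
Qed.

Lemma sub_fullE T v : (T `<=` full)%mset -> T (g v) = (g v \in T).
Proof.
by move=> /msubsetP/(_ (g v)); rewrite fullE in_mset; case: (T (g v)) => [|[]].
Qed.

Lemma full_sum T : (T `<=` full)%mset -> (\sum_(x <- T) x = \sum_v g v *+ T (g v))%R.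
Proof.
move=> TS; have us : uniq [seq g v | v <- enum V] by rewrite map_inj_uniq ?enum_uniq.
rewrite (mset_sum_uniq (fun x => x) us); first by rewrite big_map big_enum.
by move=> x /(full_supp TS)[v <-]; rewrite map_f ?mem_enum.
Qed.

Definition trace T : pred V := fun v => g v \in T.

(** As [T] is squarefree, the signs take values 0, 1, -1, and [p <> 1] separates 0 from the other
    two. *)
Lemma pm_sepset T : (T `<=` full)%mset -> pm_zero_sum G T -> sepset p (trace T).
Proof.
move=> TS /pm_zero_sumP[A [B [defT AB]]].
have AS : (A `<=` full)%mset.
  by apply: msubset_trans TS; rewrite defT; apply/msubsetP => x; rewrite msetE2 leq_addr.
have BS : (B `<=` full)%mset.
  by apply: msubset_trans TS; rewrite defT; apply/msubsetP => x; rewrite msetE2 leq_addl.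
have T1 v : A (g v) + B (g v) <= 1.
  by have := msubsetP TS (g v); rewrite fullE defT msetE2.
exists (fun v => Posz (A (g v)) - Posz (B (g v)))%R => [|v].
  apply: g_sep => [v|]; first by have := T1 v; lia.
  under eq_bigr do rewrite mulrzBr -!pmulrn.
  by rewrite sumrB -!full_sum // AB subrr.
rewrite /trace in_mset defT msetE2; have := T1 v.
case: (A (g v)) (B (g v)) => [|[|a]] [|[|b]] //= _; first by rewrite subr0 dvdz0.
  by rewrite sub0r dvdzE /= dvdn1; apply/esym/eqP.
by rewrite subr0 dvdzE /= dvdn1; apply/esym/eqP.
Qed.

Lemma depends_zero_sum i T : (T `<=` full)%mset -> depends_on i (trace T) -> zero_sum G T.
Proof.
move=> TS dT; rewrite /zero_sum /= full_sum //.
rewrite (partition_big (fun v : V => v i) predT) //= big1 // => r _.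
rewrite (eq_bigr (fun v => g v *+ (trace T (upd (base l) r)))%R); last first.
  by move=> v /eqP vr; rewrite sub_fullE // -/(trace T v) (dT v (upd (base l) r)) // upd_eq.
by rewrite sumrMnl g_slice mul0rn.
Qed.

Definition block i (r : 'I_(l i).+1) : {mset G} := gset (fun v => v i == r).

Lemma blockE i (r : 'I_(l i).+1) v : (g v \in block r) = (v i == r).
Proof. by rewrite in_mset gsetE lt0b. Qed.

Lemma block_neq0 i (r : 'I_(l i).+1) : block r <> mset0.
Proof.
move=> /msetP/(_ (g (upd (base l) r))).
by rewrite gsetE mset0E upd_eq eqxx.
Qed.

Lemma block_inj i : injective (@block i).
Proof.
move=> r r' /msetP/(_ (g (upd (base l) r))).
by rewrite !gsetE upd_eq eqxx; case: eqP.
Qed.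

Definition blocks i : {mset {mset G}} :=
  seq_mset [seq block r | r <- enum 'I_(l i).+1].

Lemma mem_blocks i u : u \in blocks i <-> exists r : 'I_(l i).+1, u = block r.
Proof.
rewrite (perm_mem (perm_eq_seq_mset _)); split=> [/mapP[r _ ->]|[r ->]].
  by exists r.
by rewrite map_f ?mem_enum.
Qed.

Lemma size_blocks i : size (blocks i) = (l i).+1.
Proof. by rewrite (perm_size (perm_eq_seq_mset _)) size_map size_enum_ord. Qed.

Lemma prod_blocks i : \big[msetD/mset0]_(u <- blocks i) u = full.
Proof.
have E x : (\big[msetD/mset0]_(u <- blocks i) u) x = \sum_(r < (l i).+1) @block i r x.
  by rewrite big_msetD_app (perm_big _ (perm_eq_seq_mset _)) big_map big_enum /=.
apply: full_ext; [apply/msubsetP => x; rewrite E | exact: gset_sub | move=> v; rewrite E].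
  have [h|h] := boolP (x \in full).
    have [v <-] := full_supp (gset_sub _) h.
    rewrite fullE (bigD1 (v i)) //= gsetE eqxx big1 // => r ri.
    by rewrite gsetE eq_sym (negPf ri).
  rewrite big1 // => r _; apply/eqP; rewrite mset_eq0.
  by apply: contra h; apply: msubset_subset; apply: gset_sub.
rewrite fullE (bigD1 (v i)) //= gsetE eqxx big1 // => r ri.
by rewrite gsetE eq_sym (negPf ri).
Qed.

Lemma blocks_inj : injective blocks.
Proof.
move=> i j ij; apply/eqP/negPn/negP => nij.
have : block (base l i) \in blocks j by rewrite -ij; apply/mem_blocks; exists (base l i).
move=> /mem_blocks[r' eb].
have [r rr'] : exists r : 'I_(l j).+1, r != r'.
  have : 0 < #|predC1 r'| by rewrite cardC1 card_ord l0.
  by move=> /card_gt0P[r ?]; exists r.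
have := blockE r' (upd (base l) r); rewrite -eb blockE upd_eq (negPf rr').
by rewrite upd_neq ?eqxx.
Qed.

Lemma disjoint_depends i A B : (A `+` B `<=` full)%mset -> A <> mset0 ->
  depends_on i (trace A) -> pm_zero_sum G B -> depends_on i (trace B).
Proof.
move=> ABS A0 dA pB.
have AS : (A `<=` full)%mset.
  by apply: msubset_trans ABS; apply/msubsetP => x; rewrite msetE2 leq_addr.
have BS : (B `<=` full)%mset.
  by apply: msubset_trans ABS; apply/msubsetP => x; rewrite msetE2 leq_addl.
have [/A0//|[x xA]] := mset_0Vmem A.
have [v def_x] := full_supp AS xA; rewrite -def_x in xA.
apply: (sepset_disjoint dA xA (pm_sepset BS pB)) => w; rewrite /trace !in_mset => Aw.
by have := msubsetP ABS (g w); rewrite fullE msetE2; lia.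
Qed.

Lemma three_parts A B T : (A `+` B `+` T `<=` full)%mset -> A <> mset0 ->
  B <> mset0 -> T <> mset0 -> pm_zero_sum G A -> pm_zero_sum G B ->
  pm_zero_sum G T ->
  exists i, [/\ depends_on i (trace A), depends_on i (trace B) & depends_on i (trace T)].
Proof.
move=> ABTS A0 B0 T0 pA pB pT.
have sub3 x : A x + B x + T x <= full x by have := msubsetP ABTS x; rewrite !msetE2.
have sub (C : {mset G}) : (forall x, C x <= A x + B x + T x) -> (C `<=` full)%mset.
  by move=> h; apply/msubsetP => x; apply: leq_trans (h x) (sub3 x).
have AS : (A `<=` full)%mset by apply: sub => x; lia.
have BS : (B `<=` full)%mset by apply: sub => x; lia.
have TS : (T `<=` full)%mset by apply: sub => x; lia.
have pt (C : {mset G}) : C <> mset0 -> (C `<=` full)%mset -> exists v, trace C v.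
  move=> C0 CS; have [/C0//|[x xC]] := mset_0Vmem C.
  by have [v vx] := full_supp CS xC; exists v; rewrite /trace vx.
have [v1 h1] := pt A A0 AS; have [v2 h2] := pt B B0 BS; have [v3 h3] := pt T T0 TS.
have dis v : ~~ (trace A v && trace B v) /\ ~~ (trace A v && trace T v) /\
    ~~ (trace B v && trace T v).
  by have := sub3 (g v); rewrite fullE /trace !in_mset; lia.
have [i dBT] := three_sepsets (pm_sepset AS pA) (pm_sepset BS pB) (pm_sepset TS pT)
  h1 h2 h3 dis.
have step (C D : {mset G}) : (forall x, C x + D x <= A x + B x + T x) -> C <> mset0 ->
    depends_on i (trace C) -> pm_zero_sum G D -> depends_on i (trace D).
  by move=> h; apply: disjoint_depends; apply: sub => x; rewrite msetE2.
by exists i; case: dBT => d; split=> //; apply: (step _ _ _ _ d) => // x; lia.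
Qed.

(** [u] is a union of slices in direction [i]. One of them and the remaining union are both
    zero-sum, so an atom consists of a single slice. *)
Lemma depends_atom_block (H : set {mset G}) i u : zero_sum G `<=` H ->
  atom H u -> (u `<=` full)%mset -> depends_on i (trace u) ->
  exists r : 'I_(l i).+1, u = block r.
Proof.
move=> zH [Hu u0 uat] uS du; have [/u0//|[x xu]] := mset_0Vmem u.
have [v def_x] := full_supp uS xu; rewrite -def_x in xu.
exists (v i); have bu : (block (v i) `<=` u)%mset.
  apply/msubsetP => y; have [yb|/mset_eq0P->//] := boolP (y \in block (v i)).
  have [w wy] := full_supp (gset_sub _) yb; rewrite -wy in yb *.
  rewrite (sub_fullE _ uS) (sub_fullE _ (gset_sub _)) -/(trace u w) (du w v) ?/trace ?xu.
    by case: (_ \in _).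
  by apply/eqP; rewrite -blockE.
have rS : (u `\` block (v i) `<=` full)%mset by apply: msubset_trans uS; apply: msubsetDl.
have zb : zero_sum G (block (v i)).
  apply: (@depends_zero_sum i); first exact: gset_sub.
  by move=> w w' ww'; rewrite /trace !blockE ww'.
have zr : zero_sum G (u `\` block (v i))%mset.
  apply: (depends_zero_sum rS (i := i)) => w w' ww'.
  rewrite /trace !in_mset !msetE2 !sub_fullE ?gset_sub // !blockE ww'.
  by rewrite -!/(trace u _) (du w w').
have := uat _ _ (zH _ zb) (zH _ zr); rewrite msetBDKC // => /(_ erefl)[/block_neq0//|r0].
by rewrite -[u](msetBDKC bu) r0 msetD0.
Qed.

(** A factor of a slice misses a parallel slice, hence depends on coordinate [i] only; if nonempty
    it is the whole slice. *)
Lemma block_atom (H : set {mset G}) i (r : 'I_(l i).+1) : zero_sum G `<=` H ->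
  H `<=` pm_zero_sum G -> atom H (block r).
Proof.
move=> zH Hpm; split; [apply: zH | exact: block_neq0 | move=> b c Hb Hc defb].
  apply: (@depends_zero_sum i); first exact: gset_sub.
  by move=> w w' ww'; rewrite /trace !blockE ww'.
have bS : (b `<=` full)%mset.
  apply: msubset_trans (gset_sub (fun v => v i == r)); rewrite -/(block r) defb.
  by apply/msubsetP => x; rewrite msetE2 leq_addr.
have bb v : g v \in b -> v i = r.
  by move=> vb; apply/eqP; rewrite -blockE defb in_msetD vb.
have [r' rr'] : exists r' : 'I_(l i).+1, r' != r.
  have : 0 < #|predC1 r| by rewrite cardC1 card_ord l0.
  by move=> /card_gt0P[r' ?]; exists r'.
have db : depends_on i (trace b).
  apply: (@sepset_avoiding_slice _ _ _ _ i r' (pm_sepset bS (Hpm _ Hb))) => v vr'.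
  by apply/negP => /bb vr; move: rr'; rewrite -vr' vr eqxx.
have [->|[x xb]] := mset_0Vmem b; first by left.
right; have [v vx] := full_supp bS xb; rewrite -vx in xb.
apply/eqP/negPn/negP => c0; have [/eqP|[y yc]] := mset_0Vmem c; first by rewrite (negPf c0).
have yblock : y \in block r by rewrite defb in_msetD yc orbT.
have [w wy] := full_supp (gset_sub _) yblock; rewrite -wy in yblock yc.
have wb : g w \in b.
  by rewrite -/(trace b w) (db w v) //; rewrite (bb v xb); apply/eqP; rewrite -blockE.
have /msetP/(_ (g w)) := defb; rewrite msetE2 /block gsetE.
by move: wb yc; rewrite !in_mset; case: (_ == _); lia.
Qed.

Lemma full_depends i : depends_on i (trace full).
Proof. by move=> v w _; rewrite /trace !in_mset !fullE. Qed.

Lemma full_zero_sum : zero_sum G full.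
Proof.
have [i _] : exists i : J, i \in J by apply/card_gt0P; apply: leq_trans J3.
exact: (depends_zero_sum (msubset_refl _) (@full_depends i)).
Qed.

Lemma full_squarefree : squarefree full.
Proof.
move=> x; have [/(full_supp (msubset_refl _))[v <-]|/mset_eq0P->//] := boolP (x \in full).
by rewrite fullE.
Qed.

(** * Factorizations of [full], for both monoids at once *)

Section Factorizations.
Variable H : set {mset G}.
Hypotheses (zH : zero_sum G `<=` H) (Hpm : H `<=` pm_zero_sum G).

Lemma summand_sub (zs : seq {mset G}) u :
  (forall x, \sum_(w <- zs) w x = full x) -> u \in zs -> (u `<=` full)%mset.
Proof.
move=> zsum uz; apply/msubsetP => x; rewrite -zsum.
by rewrite (big_rem u uz) leq_addr.
Qed.

Lemma blocks_factorization i : factorizations H full (blocks i).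
Proof.
split; last exact: prod_blocks.
by move=> u /mem_blocks[r ->]; apply: block_atom.
Qed.

(** Three factors share a coordinate by [three_parts], and disjointness extends it to all others. So
    all factors are parallel slices, and counting at one point of a slice shows that each occurs
    once. *)
Lemma long_decomposition (zs : seq {mset G}) : (forall u, u \in zs -> atom H u) ->
  (forall x, \sum_(u <- zs) u x = full x) -> 3 <= size zs ->
  exists i, perm_eq zs [seq block r | r <- enum 'I_(l i).+1].
Proof.
move=> zat zsum z3.
have [i dep] : exists i, forall u, u \in zs -> depends_on i (trace u).
  case: zs zat zsum z3 => [|u1 [|u2 [|u3 s]]] // zat zsum _.
  have [in1 in2 in3] : [/\ u1 \in [:: u1, u2, u3 & s], u2 \in [:: u1, u2, u3 & s]
      & u3 \in [:: u1, u2, u3 & s]] by rewrite !inE !eqxx !orbT.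
  have [H1 n1 _] := zat _ in1; have [H2 n2 _] := zat _ in2; have [H3 n3 _] := zat _ in3.
  have [|i [d1 d2 d3]] := @three_parts u1 u2 u3 _ n1 n2 n3 (Hpm H1) (Hpm H2) (Hpm H3).
    by apply/msubsetP => x; rewrite !msetE2 -zsum !big_cons !addnA leq_addr.
  exists i => u; rewrite !inE => /or4P[/eqP->//|/eqP->//|/eqP->//|us].
  have [Hu _ _] : atom H u by apply: zat; rewrite !inE us !orbT.
  apply: disjoint_depends n1 d1 (Hpm Hu); apply/msubsetP => x.
  by rewrite msetE2 -zsum !big_cons (big_rem u us) /=; lia.
exists i; have zblock u : u \in zs -> exists r : 'I_(l i).+1, u = block r.
  move=> uz; apply: (depends_atom_block zH (zat u uz) (summand_sub zsum uz)).
  exact: dep.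
have us : uniq [seq block r | r <- enum 'I_(l i).+1].
  by rewrite map_inj_uniq ?enum_uniq //; apply: block_inj.
have one (r : 'I_(l i).+1) : count_mem (block r) zs = 1.
  rewrite -(fullE (upd (base l) r)) -zsum -sum1_count big_mkcond /=.
  rewrite big_seq [RHS]big_seq; apply: eq_bigr => u /zblock[r' ->].
  by rewrite gsetE upd_eq (inj_eq (@block_inj i)) eq_sym; case: eqP.
apply/allP => u; rewrite mem_cat => /orP[/zblock[r ->]|/mapP[r _ ->]] /=;
  by rewrite one count_uniq_mem // map_f ?mem_enum.
Qed.

Lemma long_factorization z : factorizations H full z -> 3 <= size z ->
  exists i, z = blocks i.
Proof.
move=> [zat zS] z3; have [|i zi] := long_decomposition zat _ z3.
  by move=> x; rewrite -zS big_msetD_app.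
by exists i; rewrite -[z]seq_mset_id; apply/eq_seq_msetP.
Qed.

Lemma decomposition_size (zs : seq {mset G}) : (forall u, u \in zs -> atom H u) ->
  (forall x, \sum_(u <- zs) u x = full x) -> 2 <= size zs.
Proof.
case: zs => [|u [|u' s]] // zat zsum.
  by have := zsum (g (base l)); rewrite big_nil fullE.
have uS : u = full by apply/msetP => x; rewrite -zsum big_seq1.
have atS : atom H full by rewrite -uS; apply: zat; rewrite mem_head.
have [i _] : exists i : J, i \in J by apply/card_gt0P; apply: leq_trans J3.
have [r Sr] := depends_atom_block zH atS (msubset_refl _) (@full_depends i).
have [r' rr'] : exists r' : 'I_(l i).+1, r' != r.
  have : 0 < #|predC1 r| by rewrite cardC1 card_ord l0.
  by move=> /card_gt0P[r' ?]; exists r'.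
by have := fullE (upd (base l) r'); rewrite Sr gsetE upd_eq (negPf rr').
Qed.

Lemma factorization_size z : factorizations H full z -> 2 <= size z.
Proof.
move=> [zat zS]; apply: decomposition_size zat _ => x.
by rewrite -zS big_msetD_app.
Qed.

End Factorizations.

(** If [a] splits into nonempty [c] and [d], then [c], [d], [b] are three disjoint parts, so [a]
    depends on one coordinate and is a slice, which is an atom of the larger monoid. *)
Lemma half_atom a b : atom (zero_sum G) a -> atom (zero_sum G) b ->
  (a `+` b)%mset = full -> atom (pm_zero_sum G) a.
Proof.
move=> atA [Hb b0 _] abS; have [Ha a0 _] := atA.
split=> // [|c d pc pd defa]; first exact: zero_sum_pm.
have [->|c0] := pselect (c = mset0); first by left.
have [->|d0] := pselect (d = mset0); first by right.
have cdb : (c `+` d `+` b `<=` full)%mset by rewrite -defa abS; apply: msubset_refl.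
have [i [dc dd db]] := three_parts cdb c0 d0 b0 pc pd (zero_sum_pm Hb).
have aS : (a `<=` full)%mset by rewrite -abS; apply/msubsetP => x; rewrite msetE2 leq_addr.
have da : depends_on i (trace a).
  by move=> v w vw; have := dc v w vw; have := dd v w vw; rewrite /trace defa !in_msetD => -> ->.
have [r ar] := depends_atom_block (fun _ h => h) atA aS da.
have [_ _ h] := block_atom r (@zero_sum_pm G) (fun _ h => h).
by apply: h; rewrite -?ar.
Qed.

Lemma zero_sum_factorization_pm z : factorizations (zero_sum G) full z ->
  factorizations (pm_zero_sum G) full z.
Proof.
move=> hz; have [z3|z2] := leqP 3 (size z).
  have [i ->] := long_factorization (fun _ h => h) (@zero_sum_pm G) hz z3.
  exact: blocks_factorization (@zero_sum_pm G) (fun _ h => h) i.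
have z2' := factorization_size (fun _ h => h) hz.
have [zat zS] := hz; split=> // u uz.
have zsum x : \sum_(w <- z) w x = full x by rewrite -zS big_msetD_app.
have pz := perm_to_rem uz; move: z2' z2; rewrite (perm_size pz) /=.
case defr: (rem u z) => [|u' [|? ?]] // _ _.
have uu' x : u x + u' x = full x.
  by rewrite -zsum (perm_big _ pz) defr /= !big_cons big_nil addn0.
apply: (@half_atom u u'); first exact: zat.
  by apply: zat; rewrite (perm_mem pz) defr !inE eqxx orbT.
by apply/msetP => x; rewrite msetE2.
Qed.

End Design.

Theorem design_sequence (G : zmodType) (J : finType) (l : J -> nat) :
  infinite_set [set: G] -> 2 < #|J| -> (forall i, 0 < l i) ->
  exists (S : {mset G}) (z_ : J -> {mset {mset G}}),
    [/\ zero_sum G S /\ squarefree S,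
      injective z_ /\ forall i, size (z_ i) = (l i).+1,
      forall z, factorizations (zero_sum G) S z -> factorizations (pm_zero_sum G) S z &
      forall H, zero_sum G `<=` H -> H `<=` pm_zero_sum G ->
        (forall i, factorizations H S (z_ i)) /\
        forall z, factorizations H S z -> 2 <= size z /\
          (3 <= size z -> exists i, z = z_ i)].
Proof.
move=> Ginf J3 l0; have [p [X Xp]] := almost_free_exists Ginf.
have [g [ginj gsep gsl]] := design_exists Xp J3 l0.
have p1 : p <> 1 by case: Xp.
exists (full g), (@blocks G J l g); split.
- split; [exact: full_zero_sum | exact: full_squarefree].
- split; [exact: blocks_inj | exact: size_blocks].
- exact: (zero_sum_factorization_pm p1).
- move=> H zH Hpm; split=> [i|z hz].
    exact: (blocks_factorization p1).
  split; first exact: (factorization_size J3 l0 ginj gsl zH hz).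
  exact: (long_factorization p1 J3 ginj gsep gsl zH Hpm hz).
Qed.

(** * Adjoining a generic atom to a sequence *)

Section IndependentBlock.
Variables (G : zmodType) (p : nat) (X : set G).
Hypothesis Xp : almost_free p X.
Implicit Types (S T A B W : {mset G}).

Lemma squarefree_uniq S : squarefree S <-> uniq S.
Proof.
split=> [sqS|uS x]; last by rewrite -count_mem_mset count_uniq_mem // leq_b1.
apply: count_mem_uniq => x; rewrite count_mem_mset in_mset.
by have := sqS x; case: (S x) => [|[]].
Qed.

Definition signed_sums S : set G :=
  [set y | exists2 e : G -> int, (forall x, absz (e x) <= 1) &
                                 (y = \sum_(x <- S) x *~ e x)%R].

Lemma finite_signed_sums S : finite_set (signed_sums S).
Proof.
rewrite /signed_sums; elim: (enum_mset S) => [|x s IH].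
  by apply: sub_finite_set (finite_set1 0%R) => _ [e _ ->]; rewrite big_nil.
pose h (yc : G * int) : G := (x *~ yc.2 + yc.1)%R.
apply: sub_finite_set (finite_image h (finite_setX IH (finite_int_ball 1))).
move=> _ [e e1 ->]; rewrite big_cons.
exists (\sum_(y <- s) y *~ e y, e x)%R => //=; split=> //=.
by exists e.
Qed.

Lemma mem_signed_sums S x : uniq S -> x \in S -> signed_sums S x.
Proof.
move=> uS xS; exists (fun y => Posz (y == x)); first by move=> y; case: eqP.
rewrite (bigD1_seq x) //= eqxx mulr1z big1 ?addr0 // => y /negPf->.
by rewrite mulr0z.
Qed.

Lemma signed_sums0 S : signed_sums S 0%R.
Proof. by exists (fun=> 0%R) => //; rewrite big1 // => x _; rewrite mulr0z. Qed.

Local Open Scope ring_scope.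

Lemma signed_unit_diff (a b a' b' : nat) :
  (a + b <= 1)%N -> (a' + b' <= 1)%N -> (a + b)%N != (a' + b')%N ->
  (a%:Z - b%:Z) - (a'%:Z - b'%:Z) = 1 \/ (a%:Z - b%:Z) - (a'%:Z - b'%:Z) = -1.
Proof. by case: a b a' b' => [|[|a]] [|[|b]] [|[|a']] [|[|b']] //= *; lia. Qed.

(** [W] consists of [a], [b], [-a-b] with [a], [b] generic over the signed sums of [S]. In a signed
    relation the three signs on [W] agree modulo [p], so [W] occurs wholly or not at all and the
    part in [S] balances by itself. For [p = 2] the signs may differ, hence only occurrence is
    compared. *)
Lemma independent_block S : squarefree S -> exists W, [/\ zero_sum G W, W <> mset0,
  squarefree (S `+` W)%mset &
  forall A B, (A `+` B `<=` S `+` W)%mset -> \sum_(x <- A) x = \sum_(x <- B) x ->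
    (forall x y, x \in W -> y \in W -> (x \in (A `+` B)%mset) = (y \in (A `+` B)%mset)) /\
    \sum_(x <- (A `&` S)%mset) x = \sum_(x <- (B `&` S)%mset) x].
Proof.
move=> /squarefree_uniq uS; have [p1 _ pX _] := Xp.
have [x [Xx xP]] := generic_family bool 2 Xp (finite_signed_sums S).
pose a := x true; pose b := x false; pose c := - (a + b).
have key (al be : int) : (absz al <= 2)%N -> (absz be <= 2)%N ->
    signed_sums S (a *~ al + b *~ be) -> (p %| al)%Z /\ (p %| be)%Z.
  move=> al2 be2 h; pose co (u : bool) := if u then al else be.
  have hc : forall u, (absz (co u) <= 2)%N by case.
  have := xP co hc; rewrite big_bool => /(_ h) hu.
  by split; [exact: (hu true) | exact: (hu false)].
have kill y (k : int) : X y -> (p %| k)%Z -> y *~ k = 0.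
  move=> Xy /dvdzP[i ->]; rewrite mulrC mulrzA -pmulrn pX ?mul0rz //.
have np1 : (p %| 1)%Z -> False by rewrite dvdzE /= dvdn1 => /eqP.
have npN1 : (p %| -1)%Z -> False by rewrite dvdzE /= dvdn1 => /eqP.
pose s := [:: a, b, c & (S : seq G)].
(* A coincidence among [a], [b], [c] and the terms of [S] puts a combination with a coefficient 1 or
   -1 into the signed sums, and [p] divides neither. *)
have us : uniq s.
  rewrite /= !inE !negb_or uS andbT -!andbA; apply/and5P; split; last apply/andP; last split.
  - apply/eqP => ab; apply: np1; have [|h _] := @key 1 (-1) erefl erefl; last exact: h.
    rewrite mulr1z mulrN1z ab subrr; exact: signed_sums0.
  - apply/eqP => ac; apply: np1; have [|_ h] := @key 2 1 erefl erefl; last exact: h.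
    have h : a + b = - a by rewrite [X in - X]ac /c opprK.
    rewrite mulr1z -[a *~ 2]/(a + a) -addrA h subrr; exact: signed_sums0.
  - apply/negP => aS; apply: np1; have [|h _] := @key 1 0 erefl erefl; last exact: h.
    by rewrite mulr1z mulr0z addr0; apply: mem_signed_sums.
  - apply/eqP => bc; apply: np1; have [|h _] := @key 1 2 erefl erefl; last exact: h.
    have h : a + b = - b by rewrite [X in - X]bc /c opprK.
    rewrite mulr1z -[b *~ 2]/(b + b) addrA h addNr; exact: signed_sums0.
  - apply/negP => bS; apply: np1; have [|_ h] := @key 0 1 erefl erefl; last exact: h.
    by rewrite mulr1z mulr0z add0r; apply: mem_signed_sums.
  - apply/negP => cS; apply: npN1; have [|h _] := @key (-1) (-1) erefl erefl; last exact: h.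
    by rewrite !mulrN1z -opprD; apply: mem_signed_sums.
pose W : {mset G} := seq_mset [:: a; b; c].
have SWs : perm_eq (S `+` W)%mset s.
  rewrite (perm_trans (perm_msetD _ _)) // perm_catC -[s]/([:: a; b; c] ++ S) perm_cat2r.
  exact: perm_eq_seq_mset.
exists W; split.
- rewrite /zero_sum /= (perm_big _ (perm_eq_seq_mset _)) !big_cons big_nil /= addr0.
  by rewrite addrA subrr.
- by move=> /msetP/(_ a); rewrite mset_seqE mset0E /= eqxx.
- by apply/squarefree_uniq; rewrite (perm_uniq SWs).
move=> A B ABs sumAB; pose e y : int := (A y)%:Z - (B y)%:Z.
have AB1 y : (A y + B y <= 1)%N.
  have := msubsetP ABs y; rewrite msetE2 => h; apply: leq_trans h _.
  by rewrite -count_mem_mset count_uniq_mem ?leq_b1 // (perm_uniq SWs).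
have As y : y \in A -> y \in s.
  move=> yA; rewrite -(perm_mem SWs); apply: (msubset_subset ABs).
  by rewrite in_msetD yA.
have Bs y : y \in B -> y \in s.
  move=> yB; rewrite -(perm_mem SWs); apply: (msubset_subset ABs).
  by rewrite in_msetD yB orbT.
have e1 y : (absz (e y) <= 1)%N by have := AB1 y; rewrite /e; lia.
have sum_e : \sum_(y <- s) y *~ e y = 0.
  rewrite /e; under eq_bigr do rewrite mulrzBr -!pmulrn.
  by rewrite sumrB -!(mset_sum_uniq (fun y => y) us) // sumAB subrr.
(* Eliminating [c] leaves differences of two signs as coefficients, which is why genericity was
   requested up to 2. *)
have combo : a *~ (e a - e c) + b *~ (e b - e c) = \sum_(y <- S) y *~ (- e y).
  under eq_bigr do rewrite mulrNz.
  rewrite sumrN; move: sum_e; rewrite /s !big_cons /=.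
  move: (\sum_(_ <- _) _) (e a) (e b) (e c) => Sg ea eb ec h.
  apply/eqP; rewrite -subr_eq0 opprK -[X in _ == X]h; apply/eqP.
  rewrite /c mulNrz mulrzDl !mulrzBr opprD -!addrA; congr (_ + _).
  exact: addrCA.
have [|||pa pb] := @key (e a - e c) (e b - e c).
- by have := e1 a; have := e1 c; lia.
- by have := e1 b; have := e1 c; lia.
- by rewrite combo; exists (fun y => - e y) => // y; rewrite abszN.
have same y z : (p %| e y - e z)%Z -> (y \in (A `+` B)%mset) = (z \in (A `+` B)%mset).
  move=> pyz; rewrite !in_mset !msetE2.
  have [->//|ne] := eqVneq (A y + B y)%N (A z + B z)%N.
  have [h|h] : e y - e z = 1 \/ e y - e z = -1 := signed_unit_diff (AB1 y) (AB1 z) ne.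
    by move: pyz; rewrite h => /np1.
  by move: pyz; rewrite h => /npN1.
have toc y : y \in W -> (y \in (A `+` B)%mset) = (c \in (A `+` B)%mset).
  by rewrite (perm_mem (perm_eq_seq_mset _)) !inE => /or3P[] /eqP-> //; apply: same.
split=> [y z /toc-> /toc->//|].
have sumS (C : {mset G}) : (forall y, C y <= 1)%N ->
    \sum_(y <- (C `&` S)%mset) y = \sum_(y <- S) y *+ C y.
  move=> C1; rewrite (mset_sum_uniq (fun y => y) uS); last by move=> y; rewrite in_msetI => /andP[].
  rewrite big_seq [RHS]big_seq; apply: eq_bigr => y; rewrite in_mset msetE2 => yS.
  by rewrite (minn_idPl _) // (leq_trans (C1 y)).
rewrite !sumS; [|by move=> y; have := AB1 y; lia..].
apply/eqP; rewrite eq_sym -subr_eq0 -sumrB; apply/eqP.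
transitivity (\sum_(y <- S) y *~ (- e y)).
  by apply: eq_bigr => y _; rewrite /e opprB mulrzBr -!pmulrn.
by rewrite -combo !kill ?addr0 //; apply: Xx.
Qed.

End IndependentBlock.

Section AddBlock.
Variables (K : choiceType) (H : set {mset K}) (S W : {mset K}).
Hypotheses (HW : H W) (W0 : W <> mset0).
Hypothesis disjSW : forall x, x \in W -> x \notin S.
Hypothesis H_split : forall T, (T `<=` S `+` W)%mset -> H T ->
  exists T', [/\ H T', (T' `<=` S)%mset & T = T' \/ T = (T' `+` W)%mset].

Lemma add_block_atom : atom H W.
Proof.
split=> // b c Hb Hc defW.
have bSW : (b `<=` S `+` W)%mset.
  by apply/msubsetP => x; rewrite msetE2 defW msetE2; lia.
have [T' [HT' T'S bT']] := H_split bSW Hb.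
have T'0 : T' = mset0.
  have [->//|[x xT']] := mset_0Vmem T'.
  have /disjSW/negP[] : x \in W.
    by rewrite defW in_msetD; case: bT' => ->; rewrite ?in_msetD xT'.
  exact: (msubset_subset T'S).
case: bT' => defb; [left | right]; first by rewrite defb.
by apply: (@msetD_injl _ W); rewrite msetD0 {2}defW defb T'0 mset0D.
Qed.

Lemma big_mset_cons (u : {mset K}) (z : {mset {mset K}}) :
  \big[msetD/mset0]_(v <- ([mset u] `+` z)%mset) v =
  (u `+` \big[msetD/mset0]_(v <- z) v)%mset.
Proof.
by apply/msetP => x; rewrite msetE2 !big_msetD_app big_msetDE big_mset1E.
Qed.

(** The atom that contains a given element of [W] must contain all of [W] by [H_split], and then
    equals [W]; so every factorization has [W] as a factor. *)
Lemma add_block_factorizations :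
  factorizations H (S `+` W)%mset = (msetD [mset W]) @` factorizations H S.
Proof.
apply/seteqP; split=> [z [zat zSW]|_ [z [zat zS] <-]]; last first.
  split; last by rewrite big_mset_cons zS msetDC.
  by move=> u /msetDP[/mset1P->|/zat//]; apply: add_block_atom.
have zsum x : \sum_(u <- z) u x = S x + W x by rewrite -big_msetD_app zSW msetE2.
have [/W0//|[x xW]] := mset_0Vmem W.
have [u uz xu] : exists2 u : {mset K}, u \in z & x \in u.
  apply: contrapT => nu; have := zsum x; rewrite big_seq big1 => [|u uz].
    by move: xW; rewrite in_mset; lia.
  by apply/eqP; rewrite mset_eq0; apply/negP => xu; apply: nu; exists u.
have uSW : (u `<=` S `+` W)%mset.
  by apply/msubsetP => y; rewrite msetE2 -zsum (big_rem u uz) leq_addr.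
have [Hu u0 uat] := zat u uz; have [T' [HT' T'S uT']] := H_split uSW Hu.
have uW : u = W.
  case: uT' => defu; first by have := disjSW xW; rewrite (msubset_subset T'S) // -defu.
  by have [T'0|/W0] := uat _ _ HT' HW defu; rewrite // defu T'0 mset0D.
have Wz : ([mset W] `<=` z)%mset by rewrite msub1set -uW.
have defz := msetBDKC Wz; exists (z `\` [mset W])%mset => //; split.
  by move=> v vz; apply: zat; rewrite -defz in_msetD vz orbT.
by apply: (@msetD_injl _ W); rewrite -big_mset_cons defz zSW msetDC.
Qed.

Lemma add_block_factorizations_of_length k :
  factorizations_of_length H k.+1 (S `+` W)%mset =
  (msetD [mset W]) @` factorizations_of_length H k S.
Proof.
rewrite /factorizations_of_length add_block_factorizations.
apply/seteqP; split=> [_ /= [[z hz <-]]|_ [z [hz <-] <-]].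
  by rewrite size_msetD size_mset1 => -[sz]; exists z.
by split; [exists z | rewrite size_msetD size_mset1].
Qed.

Lemma add_block_lengths : lengths H (S `+` W)%mset = succn @` lengths H S.
Proof.
rewrite /lengths add_block_factorizations; apply/seteqP; split.
  move=> _ [_ [z hz <-] <-]; exists (size z); first by exists z.
  by rewrite size_msetD size_mset1.
move=> _ [_ [z hz <-] <-]; exists ([mset W] `+` z)%mset; first by exists z.
by rewrite size_msetD size_mset1.
Qed.

End AddBlock.

(** * Realizing sets of lengths by induction on the minimum *)

(** Inclusion and equality of the sets of factorizations replace comparisons of cardinalities, since
    they transfer directly when a block is added. *)
Definition realizes (G : zmodType) (L : set nat) (f : nat -> nat) (S : {mset G}) :=
  [/\ zero_sum G S /\ squarefree S,
      lengths (pm_zero_sum G) S = L /\ lengths (zero_sum G) S = L,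
      factorizations (zero_sum G) S `<=` factorizations (pm_zero_sum G) S,
      forall k, L k -> `I_(f k) #<= factorizations_of_length (zero_sum G) k S &
      forall m k, least L m -> L k -> m < k ->
        factorizations_of_length (zero_sum G) k S #= `I_(f k) /\
        factorizations_of_length (pm_zero_sum G) k S =
          factorizations_of_length (zero_sum G) k S].

Lemma zero_sum_submonoid (G : zmodType) : submonoid (zero_sum G).
Proof.
split; first by rewrite /zero_sum /= big_mset0.
by move=> a b; rewrite /zero_sum /= => a0 b0; rewrite big_msetDE /= a0 b0 addr0.
Qed.

Lemma realizes_succ (G : zmodType) (L : set nat) f (S : {mset G}) :
  infinite_set [set: G] -> L !=set0 -> (forall k, L k -> 0 < k) ->
  realizes [set k | L k.+1] (fun k => f k.+1) S -> exists S', @realizes G L f S'.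
Proof.
move=> Ginf [l0 Ll0] L0 [[S0 sqS] [Lpm Lzs] zpm card_ge card_eq].
have [p [X Xp]] := almost_free_exists Ginf.
have [W [W_zs W_neq0 sqSW Wsplit]] := independent_block Xp sqS.
have disj x : x \in W -> x \notin S.
  by rewrite !in_mset => Wx; have := sqSW x; rewrite msetE2; lia.
(* Stated for a pair [A], [B] to serve both monoids; the zero-sum case takes [B] empty. *)
have splitT T A B : (T `<=` S `+` W)%mset -> T = (A `+` B)%mset ->
    (\sum_(x <- A) x = \sum_(x <- B) x)%R ->
    (\sum_(x <- (A `&` S)%mset) x = \sum_(x <- (B `&` S)%mset) x)%R /\
    (T = (A `&` S) `+` (B `&` S) \/ T = (A `&` S) `+` (B `&` S) `+` W)%mset.
  move=> TSW defT AB; have ABSW : (A `+` B `<=` S `+` W)%mset by rewrite -defT.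
  have [hW hS] := Wsplit A B ABSW AB; split=> //.
  have TS x : A x + B x <= S x + W x by have := msubsetP ABSW x; rewrite !msetE2.
  have SW1 x : S x + W x <= 1 by have := sqSW x; rewrite msetE2.
  have [/W_neq0//|[w wW]] := mset_0Vmem W.
  have hx x : x \in W -> (0 < A x + B x) = (0 < A w + B w).
    by move=> xW; have := hW x w xW wW; rewrite !in_mset !msetE2.
  have [wT|wT] := posnP (A w + B w); [left | right]; apply/msetP => x;
    have := TS x; have := SW1 x; rewrite defT !msetE2;
    have [xW|/mset_eq0P Wx] := boolP (x \in W); rewrite ?Wx; try by lia.
    by have := hx x xW; rewrite wT; lia.
  by have := hx x xW; rewrite wT; move: xW; rewrite in_mset; lia.
have split_pm T : (T `<=` S `+` W)%mset -> pm_zero_sum G T ->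
    exists T', [/\ pm_zero_sum G T', (T' `<=` S)%mset & T = T' \/ T = (T' `+` W)%mset].
  move=> TSW /pm_zero_sumP[A [B [defT AB]]].
  have [hS hT] := splitT T A B TSW defT AB.
  exists ((A `&` S) `+` (B `&` S))%mset; split=> //.
    by apply/pm_zero_sumP; exists (A `&` S)%mset, (B `&` S)%mset.
  apply/msubsetP => x; have := msubsetP TSW x; have := sqSW x.
  by rewrite defT !msetE2; lia.
have split_zs T : (T `<=` S `+` W)%mset -> zero_sum G T ->
    exists T', [/\ zero_sum G T', (T' `<=` S)%mset & T = T' \/ T = (T' `+` W)%mset].
  move=> TSW T0; have TT : T = (T `+` mset0)%mset by rewrite msetD0.
  have [|hS hT] := splitT T T mset0 TSW TT; first by rewrite T0 big_mset0.
  exists (T `&` S)%mset; rewrite /zero_sum /= hS mset0I big_mset0; split=> //.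
    exact: msubsetIr.
  by move: hT; rewrite mset0I msetD0.
have W_pm := zero_sum_pm W_zs.
have L_succ : succn @` [set k | L k.+1] = L.
  apply/seteqP; split=> [_ [k Lk <-] //|k Lk].
  by exists k.-1; rewrite /= prednK // L0.
exists (S `+` W)%mset; split.
- by split; [apply: (@zero_sum_submonoid G).2 | exact: sqSW].
- by rewrite !add_block_lengths // Lpm Lzs L_succ.
- by rewrite !add_block_factorizations // => _ [z /zpm hz <-]; exists z.
- move=> [/L0//|k] Lk; rewrite add_block_factorizations_of_length //.
  apply: card_le_trans (card_ge k Lk) _.
  have e := inj_card_eq (A := factorizations_of_length (zero_sum G) k S)
    (in2W (@msetD_injl _ [mset W]%mset)).
  by have := card_esym e; rewrite card_eq_le => /andP[].
- move=> [|m] [|k] [Lm mlow] Lk mk //; first by have := L0 _ Lm.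
  have [|h1 h2] := card_eq m k _ Lk mk.
    by split=> // i Li; have := mlow i.+1 Li.
  rewrite !add_block_factorizations_of_length // h2; split=> //.
  apply: card_eq_trans h1; apply: inj_card_eq; exact: (in2W (@msetD_injl _ _)).
Qed.

Lemma realizes_min2 (G : zmodType) (L : set nat) f : infinite_set [set: G] ->
  finite_set L -> (forall k, L k -> 2 <= k) -> (forall k, L k -> 0 < f k) -> L 2 ->
  exists S, @realizes G L f S.
Proof.
(* Three additional indices of length 2 make [J] large enough for the design. The surplus is
   harmless, as at the minimum of [L] only a lower bound on the number of factorizations is
   claimed. *)
move=> Ginf /finite_seqP[s Ls] L2 f0 L_2; pose f' k := f k + 3 * (k == 2).
have sL (k : seq_sub s) : L (val k) by rewrite Ls; exact: valP.
pose J := {k : seq_sub s & 'I_(f' (val k))}.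
pose l (i : J) := (val (tag i)).-1.
have lS i : (l i).+1 = val (tag i) by rewrite prednK // (ltn_trans _ (L2 _ (sL _))).
have l0 i : 0 < l i by rewrite -ltnS lS; apply: L2.
have s2 : 2 \in s by have := L_2; rewrite Ls.
have J3 : 2 < #|{: J}|.
  pose h (j : 'I_3) : J := Tagged (fun k : seq_sub s => 'I_(f' (val k)))
     (i := SeqSub s2) (rshift (f 2) j).
  rewrite -[3]card_ord; apply: (@leq_card _ _ h) => i j.
  by move=> /eqP; rewrite eq_Tagged => /eqP /rshift_inj.
have [S [z_ [[S0 sqS] [z_inj z_size] zpm hz]]] := design_sequence Ginf J3 l0.
have [zs_z zs_long] := hz (zero_sum G) (fun _ h => h) (@zero_sum_pm G).
have [pm_z pm_long] := hz (pm_zero_sum G) (@zero_sum_pm G) (fun _ h => h).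
pose Jk k := [set i : J | val (tag i) = k].
have card_Jk k : L k -> z_ @` Jk k #= `I_(f' k).
  move=> Lk; have ks : k \in s by move: Lk; rewrite Ls.
  apply: card_eq_trans (inj_card_eq (in2W z_inj)) _.
  pose h (j : 'I_(f' k)) : J := Tagged (fun k : seq_sub s => 'I_(f' (val k)))
     (i := SeqSub ks) j.
  have -> : Jk k = h @` setT.
    apply/seteqP; split=> [[k' j] /= kk'|_ [j _ <-] //].
    have ek : k' = SeqSub ks by apply: val_inj.
    by move: j {kk'}; rewrite ek => j; exists j.
  apply: card_eq_trans (card_esym card_II); apply: inj_card_eq => i j _ _.
  by move=> /eqP; rewrite eq_Tagged => /eqP.
have long H : zero_sum G `<=` H -> H `<=` pm_zero_sum G -> forall k, 2 < k ->
    factorizations_of_length H k S = z_ @` Jk k.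
  move=> zH Hpm k k2; have [Hz Hlong] := hz H zH Hpm; apply/seteqP; split.
    move=> z [hzS sz]; have [_ h] := Hlong z hzS.
    rewrite -sz in k2; have [i defz] := h k2; exists i => //.
    by rewrite /Jk /= -lS -z_size -defz.
  by move=> _ [i ik <-]; split; [exact: Hz | rewrite z_size lS].
have len H : zero_sum G `<=` H -> H `<=` pm_zero_sum G -> lengths H S = L.
  move=> zH Hpm; have [Hz Hlong] := hz H zH Hpm; apply/seteqP; split=> k.
    move=> [z hzS sz]; have [z2 h] := Hlong z hzS.
    move: z2; rewrite leq_eqVlt => /predU1P[e|/h[i defz]]; first by rewrite -sz -e.
    by rewrite -sz defz z_size lS; apply: sL.
  move=> Lk; have ks : k \in s by move: Lk; rewrite Ls.
  have fk : 0 < f' k by rewrite addn_gt0 f0.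
  pose i : J := Tagged (fun k : seq_sub s => 'I_(f' (val k)))
    (i := SeqSub ks) (Ordinal fk).
  by exists (z_ i); [exact: Hz | rewrite z_size lS].
exists S; split=> //.
- by rewrite !len //; exact: zero_sum_pm.
- move=> k Lk; apply: (@card_le_trans _ _ _ `I_(f' k)).
    by rewrite card_le_II leq_addr.
  have := card_esym (card_Jk k Lk); rewrite card_eq_le => /andP[h _].
  apply: card_le_trans h _; apply: subset_card_le => _ [i ik <-]; split.
    exact: zs_z.
  by rewrite z_size lS.
- move=> m k [Lm mmin] Lk mk; have k2 : 2 < k by apply: leq_ltn_trans (L2 _ Lm) mk.
  rewrite !long //; try exact: zero_sum_pm.
  split=> //; apply: card_eq_trans (card_Jk k Lk) _.
  by rewrite /f' gtn_eqF // addn0.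
Qed.

Theorem infinite_realization (G : zmodType) : infinite_set [set: G] ->
  forall (L : set nat) f, finite_set L -> L !=set0 -> (forall k, L k -> 2 <= k) ->
    (forall k, L k -> 0 < f k) -> exists S, @realizes G L f S.
Proof.
move=> Ginf L f Lfin [k0 Lk0].
have ex : exists k, `[< L k >] by exists k0; apply/asboolP.
have [m /asboolP Lm mmin] := ex_minnP ex.
have {mmin} Lge k : L k -> m <= k by move=> Lk; apply: mmin; apply/asboolP.
(* Each induction step lowers [L] by one and adds one block, until the minimum is 2. *)
move=> L2 f0; have [t def_m] : exists t, m = t + 2.
  by exists (m - 2); rewrite subnK // L2.
elim: t m def_m L f Lfin {k0 Lk0 ex} Lm Lge f0 {L2} => [|t IH] m -> L f Lfin Lm Lge f0.
  exact: realizes_min2.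
have [||||S hS] := IH (t + 2) erefl [set k | L k.+1] (fun k => f k.+1).
- by apply: finite_preimage => // i j _ _ [].
- by [].
- by move=> k /Lge; rewrite addSn.
- by move=> k /f0.
apply: (realizes_succ Ginf _ _ hS); first by exists (t.+1 + 2).
by move=> k /Lge; case: k.
Qed.

Theorem theorem1p1 (G : zmodType) :
  (finite_set [set: G] ->
   exists M : nat, forall S : {mset G}, pm_zero_sum G S ->
     (exists2 d : nat, minimal_distances (pm_zero_sum G) d &
        AAMP d M (int_set (lengths (pm_zero_sum G) S)))
     \/ ([set: G] #<= `I_2 /\
         exists n : nat, lengths (pm_zero_sum G) S = [set n]))
  /\
  (infinite_set [set: G] ->
   forall (L : set nat) (f : nat -> nat),
     finite_set L -> L !=set0 -> (forall k, L k -> (2 <= k)%N) ->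
     (forall k, L k -> (0 < f k)%N) ->
   exists S : {mset G},
     [/\ zero_sum G S,
         squarefree S,
         lengths (pm_zero_sum G) S = L /\ lengths (zero_sum G) S = L,
         (forall k, L k ->
            `I_(f k) #<= factorizations_of_length (zero_sum G) k S /\
            factorizations_of_length (zero_sum G) k S
              #<= factorizations_of_length (pm_zero_sum G) k S) &
         (forall m k, least L m -> L k -> (m < k)%N ->
            factorizations_of_length (zero_sum G) k S #= `I_(f k) /\
            factorizations_of_length (pm_zero_sum G) k S
              #= factorizations_of_length (zero_sum G) k S)]).
Proof.
split=> [|Ginf L f Lfin L0 L2 f0]; first exact: pm_zero_sum_structure.
have [S [[S0 sqS] Llen zpm card_ge card_eq]] := infinite_realization Ginf Lfin L0 L2 f0.
exists S; split=> // [k Lk|m k lm Lk mk].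
  split; first exact: card_ge.
  by apply: subset_card_le => z [/zpm hz sz].
have [h1 h2] := card_eq m k lm Lk mk.
by split=> //; rewrite h2.
Qed.
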